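(* Let $(M,g_{ab},u,Y_{ab},\xi^a[Y],\lambda)$ be an Einstein CKY--RS structure with $M$ connected of dimension $n\ge3$ and $R_{ab}=\Lambda g_{ab}$, let $\phi=e^{-u}$, and suppose $d\phi\not\equiv0$. Set $\alpha=c-\lambda$, where $c=\lambda-\xi(u)$ is the (constant) Einstein constant of $\tilde g=e^{2u}g$, and suppose $\alpha\neq0$. Then $c=0$ and $$(n-1)|\nabla\phi|^2=-\Lambda\phi^2 .$$ Consequently: 1. If $g$ is Riemannian, then necessarily $\Lambda<0$. 2. If $g$ is Lorentzian, then $\Lambda>0$ implies that $d\phi$ is timelike, $\Lambda=0$ implies that $d\phi$ is null, and $\Lambda<0$ implies that $d\phi$ is spacelike.
   Context: Lorentzian signature is $(-,+,\dots,+)$, so timelike covectors have negative norm squared. $|\nabla\phi|^2=g^{ab}\nabla_a\phi\nabla_b\phi$. Conformal Killing--Yano (CKY) 2-form on an $n$-dimensional pseudo-Riemannian manifold: a smooth 2-form $Y_{ab}$ with $\nabla_cY_{ab}=g_{ca}\xi_b-g_{cb}\xi_a+z_{abc}$, where $z_{abc}$ is totally antisymmetric and $\xi_a=\frac{1}{n-1}\nabla^bY_{ba}$; $\xi^a=\xi^a[Y]$ is its associated vector field. CKY--RS structure $(M,g_{ab},u,Y_{ab},\xi^a[Y],\lambda)$: $u\in C^\infty(M)$, $\lambda\in\mathbb{R}$, $Y$ is a CKY 2-form of $g$, and $\tilde g_{ab}=e^{2u}g_{ab}$ satisfies $\tilde R_{ab}+\frac12\mathcal{L}_{\xi}\tilde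 g_{ab}=\lambda\tilde g_{ab}$ with $\xi=\xi[Y]$, $\tilde R_{ab}$ being the Ricci tensor of $\tilde g$. It is an Einstein CKY--RS structure if the background $g$ is Einstein, $R_{ab}=\Lambda g_{ab}$ with $\Lambda$ constant. On an Einstein background $\xi$ is a Killing field of $g$, $\tilde R_{ab}=c\,\tilde g_{ab}$ with $c=\lambda-\xi(u)$ constant, and $\mathcal{L}_\xi\phi=\alpha\phi$. *)

(* Defs.v *)
From HB Require Import structures.
From mathcomp Require Import all_boot all_order all_algebra.
From mathcomp Require Import all_classical all_reals all_analysis.

Set Implicit Arguments.
Unset Strict Implicit.
Unset Printing Implicit Defensive.

Import Order.TTheory GRing.Theory Num.Theory.
Import numFieldNormedType.Exports.

Local Open Scope classical_set_scope.
Local Open Scope ring_scope.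

(* Tensor fields are handled through their components in the charts of an     *)
(* atlas.  Inside a chart a scalar field is a function 'rV[R]_n -> R, a       *)
(* (co)vector field a function 'rV[R]_n -> 'rV[R]_n and a covariant 2-tensor  *)
(* field a function 'rV[R]_n -> 'M[R]_n; only their values on the (open)      *)
(* image of the chart are meaningful.                                         *)

Section CoordinateCalculus.
Context {R : realType} {n : nat}.
Local Notation E := 'rV[R]_n.

Definition pd (k : 'I_n) (f : E -> R) : E -> R :=
  fun x => 'D_(delta_mx 0 k) f x.

Definition iter_pd (s : seq 'I_n) (f : E -> R) : E -> R := foldr pd f s.

(* C^infinity on U (meant for U open): the partial derivatives of all orders  *)
(* are Frechet differentiable at every point of U.                            *)
Definition smooth_on (U : set E) (f : E -> R) : Prop :=
  forall (s : seq 'I_n) (x : E), U x -> differentiable (iter_pd s f) x.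

Definition grad (f : E -> R) (x : E) : 'rV[R]_n := \row_k pd k f x.

Definition jac (f : E -> E) (x : E) : 'M[R]_n :=
  \matrix_(a, b) pd a (fun y => f y 0 b) x.

(* Gamma^k_{ij} *)
Definition christoffel (g : E -> 'M[R]_n) (k i j : 'I_n) (x : E) : R :=
  2^-1 * \sum_l invmx (g x) k l *
    (pd i (fun y => g y l j) x + pd j (fun y => g y l i) x
     - pd l (fun y => g y i j) x).

(* R^d_{cab}, with [nabla_a, nabla_b] V^d = R^d_{cab} V^c *)
Definition riemann (g : E -> 'M[R]_n) (d c a b : 'I_n) (x : E) : R :=
  pd a (christoffel g d b c) x - pd b (christoffel g d a c) x
  + \sum_e (christoffel g d a e x * christoffel g e b c x
            - christoffel g d b e x * christoffel g e a c x).

(* R_{ab} = R^c_{acb}; positive on round spheres *)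
Definition ricci (g : E -> 'M[R]_n) (x : E) : 'M[R]_n :=
  \matrix_(a, b) \sum_c riemann g c a c b x.

(* nabla_c T_{ab} *)
Definition nabla2 (g T : E -> 'M[R]_n) (c a b : 'I_n) (x : E) : R :=
  pd c (fun y => T y a b) x
  - \sum_d (christoffel g d c a x * T x d b + christoffel g d c b x * T x a d).

(* (L_X T)_{ab}, X contravariant *)
Definition lie2 (X : E -> 'rV[R]_n) (T : E -> 'M[R]_n) (x : E) : 'M[R]_n :=
  \matrix_(a, b) \sum_c
    (X x 0 c * pd c (fun y => T y a b) x
     + T x c b * pd a (fun y => X y 0 c) x
     + T x a c * pd b (fun y => X y 0 c) x).

Definition lie0 (X : E -> 'rV[R]_n) (f : E -> R) (x : E) : R :=
  \sum_a X x 0 a * pd a f x.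

(* g^{ab} w_a w_b for a covector w, where G = (g_{ab}) *)
Definition covec_normsq (G : 'M[R]_n) (w : 'rV[R]_n) : R :=
  \sum_a \sum_b invmx G a b * w 0 a * w 0 b.

(* xi_a = (n-1)^{-1} nabla^b Y_{ba} *)
Definition cky_covec (g Y : E -> 'M[R]_n) (x : E) : 'rV[R]_n :=
  \row_a ((n%:R - 1)^-1 *
          \sum_b \sum_c invmx (g x) b c * nabla2 g Y c b a x).

(* xi^a = g^{ab} xi_b *)
Definition cky_vec (g Y : E -> 'M[R]_n) (x : E) : 'rV[R]_n :=
  \row_a \sum_b invmx (g x) a b * cky_covec g Y x 0 b.

Definition totally_antisym (z : 'I_n -> 'I_n -> 'I_n -> R) : Prop :=
  forall a b c, z a b c = - z b a c /\ z a b c = - z a c b.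

Definition cky_eq (g Y : E -> 'M[R]_n) (x : E) : Prop :=
  exists2 z : 'I_n -> 'I_n -> 'I_n -> R, totally_antisym z &
    forall c a b, nabla2 g Y c a b x =
      g x c a * cky_covec g Y x 0 b - g x c b * cky_covec g Y x 0 a + z a b c.

Definition positive_definite (G : 'M[R]_n) : Prop :=
  forall v : 'rV[R]_n, v != 0 -> 0 < (v *m G *m v^T) 0 0.

(* signature (-,+,...,+) *)
Definition lorentzian_form (G : 'M[R]_n) : Prop :=
  exists2 P : 'M[R]_n, P \in unitmx &
    P *m G *m P^T = diag_mx (\row_j (if j == 0%N :> nat then -1 else 1)).

Definition timelike_covec (G : 'M[R]_n) (w : 'rV[R]_n) : Prop :=
  covec_normsq G w < 0.

Definition null_covec (G : 'M[R]_n) (w : 'rV[R]_n) : Prop :=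
  w != 0 /\ covec_normsq G w = 0.

Definition spacelike_covec (G : 'M[R]_n) (w : 'rV[R]_n) : Prop :=
  0 < covec_normsq G w.

End CoordinateCalculus.

(* A chart: a homeomorphism fwd from the open set dom onto the open set cod   *)
(* of R^n, with inverse bwd.                                                  *)
Record chart (R : realType) (n : nat) (M : topologicalType) := Chart {
  dom : set M;
  cod : set 'rV[R]_n;
  fwd : M -> 'rV[R]_n;
  bwd : 'rV[R]_n -> M;
  dom_open : open dom;
  cod_open : open cod;
  fwd_cod : forall p, dom p -> cod (fwd p);
  bwd_dom : forall x, cod x -> dom (bwd x);
  fwdK : forall p, dom p -> bwd (fwd p) = p;
  bwdK : forall x, cod x -> fwd (bwd x) = x;
  fwd_cont : forall p, dom p -> {for p, continuous fwd};
  bwd_cont : forall x, cod x -> {for x, continuous bwd}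
}.

Definition overlap (R : realType) (n : nat) (M : topologicalType)
    (c1 c2 : chart R n M) : set 'rV[R]_n :=
  [set x | cod c1 x /\ dom c2 (bwd c1 x)].

Definition transition (R : realType) (n : nat) (M : topologicalType)
    (c1 c2 : chart R n M) : 'rV[R]_n -> 'rV[R]_n :=
  fun x => fwd c2 (bwd c1 x).

(* Smooth n-manifolds without boundary, with a (not necessarily maximal)      *)
(* smooth atlas.                                                              *)
Record manifold (R : realType) (n : nat) := Manifold {
  carrier :> topologicalType;
  mfd_hausdorff : hausdorff_space carrier;
  mfd_countable : @second_countable carrier;
  idx : Type;
  chrt : idx -> chart R n carrier;
  atlas_cover : forall p : carrier, exists i, dom (chrt i) p;
  atlas_smooth : forall (i j : idx) (k : 'I_n),
    smooth_on (overlap (chrt i) (chrt j))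
      (fun x => transition (chrt i) (chrt j) x 0 k)
}.

(* Smooth covariant 2-tensor fields: T'_{ab} = d_a y^c d_b y^d T_{cd}(y) under *)
(* a change of coordinates x |-> y.                                           *)
Record tensor2 (R : realType) (n : nat) (M : manifold R n) := Tensor2 {
  comp :> idx M -> 'rV[R]_n -> 'M[R]_n;
  comp_smooth : forall i a b,
    smooth_on (cod (chrt i)) (fun x => comp i x a b);
  comp_change : forall i j x, overlap (chrt i) (chrt j) x ->
    let J := jac (transition (chrt i) (chrt j)) x in
    comp i x = J *m comp j (transition (chrt i) (chrt j) x) *m J^T
}.

Section Structures.
Context {R : realType} {n : nat} (M : manifold R n).
Implicit Types (g Y : tensor2 M) (u f : M -> R).

(* coordinate expression of a scalar field *)
Definition loc f (i : idx M) : 'rV[R]_n -> R := fun x => f (bwd (chrt i) x).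

Definition smooth_scalar f : Prop :=
  forall i, smooth_on (cod (chrt i)) (loc f i).

Definition in_charts (P : idx M -> 'rV[R]_n -> Prop) : Prop :=
  forall i x, cod (chrt i) x -> P i x.

Definition pseudo_riemannian g : Prop :=
  in_charts (fun i x => (g i x)^T = g i x /\ g i x \in unitmx).

Definition riemannian g : Prop :=
  pseudo_riemannian g /\ in_charts (fun i x => positive_definite (g i x)).

Definition lorentzian g : Prop :=
  pseudo_riemannian g /\ in_charts (fun i x => lorentzian_form (g i x)).

Definition two_form Y : Prop := in_charts (fun i x => (Y i x)^T = - Y i x).

Definition cky_form g Y : Prop :=
  two_form Y /\ in_charts (fun i x => cky_eq (g i) (Y i) x).

(* e^{2u} g *)
Definition conformal g u (i : idx M) (x : 'rV[R]_n) : 'M[R]_n :=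
  expR (2 * loc u i x) *: g i x.

Definition cky_rs g u Y (lambda : R) : Prop :=
  [/\ pseudo_riemannian g, smooth_scalar u, cky_form g Y &
      in_charts (fun i x =>
        ricci (conformal g u i) x
        + 2^-1 *: lie2 (cky_vec (g i) (Y i)) (conformal g u i) x
        = lambda *: conformal g u i x)].

Definition einstein (h : idx M -> 'rV[R]_n -> 'M[R]_n) (Lambda : R) : Prop :=
  in_charts (fun i x => ricci (h i) x = Lambda *: h i x).

Definition einstein_cky_rs g u Y (lambda Lambda : R) : Prop :=
  cky_rs g u Y lambda /\ einstein g Lambda.

End Structures.

(* Main.v *)
Require Import Defs.
From HB Require Import structures.
From mathcomp Require Import all_boot all_order all_algebra.
From mathcomp Require Import all_classical all_reals all_analysis.
From mathcomp Require Import ring lra zify.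
Import Order.TTheory GRing.Theory Num.Theory.
Import numFieldNormedType.Exports.
Local Open Scope classical_set_scope.
Local Open Scope ring_scope.

(** Put phi = e^{-u}.  Contracting the Ricci identity for Y_{ab} against g^{ca}
    shows that xi is Killing on an Einstein background, so that the soliton
    equation reads R~ = c g~ with c = lambda - xi(u).  By the conformal change
    formula for the Ricci tensor, Hess phi = s g for some function s and
    c = Lambda phi^2 + 2 (n - 1) phi s - (n - 1) |d phi|^2.  The Ricci identity
    for d phi gives (n - 1) ds = - Lambda d phi, so that c and
    K = Lambda phi + (n - 1) s are locally constant.  Differentiating
    xi(phi) = alpha phi and contracting with d phi gives
    s alpha phi = alpha |d phi|^2.  If alpha <> 0 then c = K phi, and K <> 0
    would make phi locally constant, against xi(phi) = alpha phi; hence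
    K = c = 0 and (n - 1) |d phi|^2 = - Lambda phi^2.

    The values c, c' computed in two charts are compared without proving that
    xi is a tensor: c = - (n - 1) |d phi|^2 - Lambda phi^2 + 2 K phi and the
    invariance of |d phi|^2 give c - c' = 2 (K - K') phi on the overlap, with
    c - c' and K - K' locally constant.  Either K = K', or phi is locally
    constant and then K = Lambda phi = K' because s = s' = 0.

    In a chart, tensor calculus is done over the commutative ring of smooth
    functions with its commuting derivations d_c, the Christoffel symbols being
    one n x n matrix for each c. *)

(** * Smooth functions of several variables *)

Section PartialDerivatives.
Context {R : realType} {n : nat}.
Local Notation E := 'rV[R]_n.
Implicit Types (f g : E -> R) (x : E) (U : set E).

(** Differentiability depends only on the germ of a function. The case of the zero germ, where the
    remainder vanishes identically near the point, suffices: [near_eq_differentiable] writes [g] as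
    [f] plus such a germ. *)
Lemma near_zero_is_diff {V W : normedModType R} (f : V -> W) (x : V) :
  (\forall y \near x, f y = 0) -> is_diff x f (\0 : V -> W).
Proof.
move=> fx0.
have loc : f \o shift x = cst (f x) + \0 +o_ 0 id.
  apply/eqaddoP => _ /posnumP[e]; near=> y.
  have fx : f x = 0 by exact: (nbhs_singleton fx0).
  have fy : f (y + x) = 0.
    near: y; move: fx0; rewrite (near_shift 0 x) /=; apply: filterS => y /=.
    by rewrite subr0.
  by rewrite /= /GRing.add/= fx fy /cst/= /GRing.opp/= addr0 subr0 normr0 mulr_ge0.
have d0 : 'd f x = \0 :> (V -> W) by apply: diff_unique => //; exact: cst_continuous.
split => //.
by apply/diff_locallyP; rewrite d0; split => //; exact: cst_continuous.
Unshelve. all: by end_near. Qed.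

Lemma near_eq_differentiable {V W : normedModType R} (f g : V -> W) (x : V) :
  (\forall y \near x, f y = g y) -> differentiable f x -> differentiable g x.
Proof.
move=> fg df; have -> : g = f + (g - f) by rewrite addrC subrK.
have fg0 : \forall y \near x, (g - f) y = 0.
  by apply: filterS fg => y /= e; rewrite /GRing.add/= /GRing.opp/= e subrr.
by apply: differentiableD => //; have [] := near_zero_is_diff _ _ fg0.
Qed.

Lemma near_eq_pd f g x k : (\forall y \near x, f y = g y) -> pd k f x = pd k g x.
Proof. exact: near_eq_derive. Qed.

Lemma eq_on_pd {U f g x} k : open U -> U x -> (forall y, U y -> f y = g y) ->
  pd k f x = pd k g x.
Proof.
move=> oU Ux fg; apply: near_eq_pd; apply: filterS fg _.
exact: open_nbhs_nbhs.
Qed.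

Lemma pdD f g x k : differentiable f x -> differentiable g x ->
  pd k (fun y => f y + g y) x = pd k f x + pd k g x.
Proof. by move=> df dg; rewrite /pd deriveD//; exact: diff_derivable. Qed.

Lemma pdN f x k : differentiable f x -> pd k (fun y => - f y) x = - pd k f x.
Proof. by move=> df; rewrite /pd deriveN//; exact: diff_derivable. Qed.

Lemma pdM f g x k : differentiable f x -> differentiable g x ->
  pd k (fun y => f y * g y) x = pd k f x * g x + f x * pd k g x.
Proof.
move=> df dg; rewrite /pd deriveM//; [|exact: diff_derivable..].
by rewrite -!/(_ *: _ : R) /GRing.scale/= addrC; congr (_ + _); rewrite mulrC.
Qed.

Lemma pd_cst (c : R) x k : pd k (fun=> c) x = 0.
Proof. exact: derive_cst. Qed.

Lemma pdV f x k : differentiable f x -> f x != 0 ->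
  pd k (fun y => (f y)^-1) x = - (f x)^-1 * (f x)^-1 * pd k f x.
Proof.
move=> df f0; rewrite /pd deriveV//; last exact: diff_derivable.
by rewrite /GRing.scale/= -exprVn; ring.
Qed.

Lemma pd_comp1 (h : R -> R) (h' : R) f x k : differentiable f x ->
  is_derive (f x) 1 h h' -> pd k (fun y => h (f y)) x = h' * pd k f x.
Proof.
move=> df dh; have /derivable1_diffP ddh := @ex_derive _ _ _ _ _ _ _ dh.
rewrite /pd -[fun y => _]/(h \o f).
rewrite deriveE; last exact: differentiable_comp.
rewrite diff_comp //= [in RHS]deriveE // -[X in 'd h _ X]mulr1.
have e : 'd h (f x) 1 = h' by rewrite -deriveE //; exact: derive_val.
by rewrite [LHS]linearZ /= e /GRing.scale/= mulrC.
Qed.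

(** While [iter_pd] adds derivatives on the outside, [Cn] peels off the innermost one and bounds the
    order. This makes smoothness of sums, products, inverses and exponentials an induction on m. *)
Fixpoint Cn (m : nat) U f : Prop :=
  (forall x, U x -> differentiable f x) /\
  if m is m'.+1 then forall k, Cn m' U (pd k f) else True.

Lemma Cn_diff {m U f} : Cn m U f -> forall x, U x -> differentiable f x.
Proof. by case: m => [|m] []. Qed.

Lemma CnW {m U f} : Cn m.+1 U f -> Cn m U f.
Proof.
elim: m f => [|m IH] f [df pf]; split => // k; exact/IH/pf.
Qed.

Lemma iter_pd_rcons (s : seq 'I_n) k f : iter_pd (rcons s k) f = iter_pd s (pd k f).
Proof. by rewrite /iter_pd foldr_rcons. Qed.

Lemma smooth_pd {U f} k : smooth_on U f -> smooth_on U (pd k f).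
Proof. by move=> sf s x Ux; rewrite -iter_pd_rcons; exact: sf. Qed.

Lemma smooth_onP U f : smooth_on U f <-> forall m, Cn m U f.
Proof.
split=> [sf m|cf s].
  elim: m f sf => [|m IH] f sf; split => //.
  - exact: (sf [::]).
  - exact: (sf [::]).
  - by move=> k; apply: IH; exact: smooth_pd.
elim/last_ind: s f cf => [|s k IH] f cf x Ux; first exact: (Cn_diff (cf 0%N)).
rewrite iter_pd_rcons; apply: IH => // m; have [_] := cf m.+1; exact.
Qed.

Lemma eq_on_Cn {U m f g} : open U -> (forall y, U y -> f y = g y) ->
  Cn m U f -> Cn m U g.
Proof.
move=> oU; elim: m f g => [|m IH] f g fg cf.
  split => // x Ux; apply: near_eq_differentiable (Cn_diff cf x Ux).
  by apply: filterS fg _; exact: open_nbhs_nbhs.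
split=> [x Ux|k].
  apply: near_eq_differentiable (Cn_diff cf x Ux).
  by apply: filterS fg _; exact: open_nbhs_nbhs.
by have [_ pf] := cf; apply: IH (pf k) => y Uy; exact: eq_on_pd oU Uy fg.
Qed.

Lemma Cn_cst {U} m (c : R) : open U -> Cn m U (fun=> c).
Proof.
move=> oU; elim: m c => [|m IH] c; split => //; try by move=> x _; exact: differentiable_cst.
by move=> k; apply: eq_on_Cn (IH 0) => // y _; rewrite pd_cst.
Qed.

Lemma CnD {U m f g} : open U -> Cn m U f -> Cn m U g -> Cn m U (fun y => f y + g y).
Proof.
move=> oU; elim: m f g => [|m IH] f g cf cg.
  split => // x Ux; apply: (@differentiableD _ _ _ f g);
    [exact: (Cn_diff cf)|exact: (Cn_diff cg)].
split=> [x Ux|k]; first by apply: (@differentiableD _ _ _ f g);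
    [exact: (Cn_diff cf)|exact: (Cn_diff cg)].
have [_ pf] := cf; have [_ pg] := cg.
apply: eq_on_Cn (IH _ _ (pf k) (pg k)) => // y Uy.
by rewrite pdD//; [exact: (Cn_diff cf)|exact: (Cn_diff cg)].
Qed.

Lemma CnM {U m f g} : open U -> Cn m U f -> Cn m U g -> Cn m U (fun y => f y * g y).
Proof.
move=> oU; elim: m f g => [|m IH] f g cf cg.
  split => // x Ux; apply: (@differentiableM _ _ f g);
    [exact: (Cn_diff cf)|exact: (Cn_diff cg)].
split=> [x Ux|k]; first by apply: (@differentiableM _ _ f g);
    [exact: (Cn_diff cf)|exact: (Cn_diff cg)].
apply: (@eq_on_Cn _ _ (fun y => pd k f y * g y + f y * pd k g y)) => //.
  by move=> y Uy; rewrite pdM//; [exact: (Cn_diff cf)|exact: (Cn_diff cg)].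
have [_ pf] := cf; have [_ pg] := cg.
by apply: CnD => //; apply: IH; [exact: pf|exact: CnW|exact: CnW|exact: pg].
Qed.

Lemma smooth_ext {U f} g : open U -> (forall y, U y -> f y = g y) ->
  smooth_on U f -> smooth_on U g.
Proof. by move=> oU fg /smooth_onP cf; apply/smooth_onP => m; exact: eq_on_Cn oU fg (cf m). Qed.

Lemma smooth_cst {U} (c : R) : open U -> smooth_on U (fun=> c).
Proof. by move=> oU; apply/smooth_onP => m; exact: Cn_cst. Qed.

Lemma smoothD {U f g} : open U -> smooth_on U f -> smooth_on U g ->
  smooth_on U (fun y => f y + g y).
Proof.
move=> oU /smooth_onP cf /smooth_onP cg; apply/smooth_onP => m; exact: CnD.
Qed.

Lemma smoothM {U f g} : open U -> smooth_on U f -> smooth_on U g ->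
  smooth_on U (fun y => f y * g y).
Proof.
move=> oU /smooth_onP cf /smooth_onP cg; apply/smooth_onP => m; exact: CnM.
Qed.

Lemma smooth_diff {U f} : smooth_on U f -> forall x, U x -> differentiable f x.
Proof. by move=> sf; exact: (sf [::]). Qed.

(** A first derivative of 1/f is a product of copies of 1/f and a derivative of f, so order m + 1
    asks for 1/f itself only at order m. The exponential below is treated in the same way. *)
Lemma smoothV {U f} : open U -> smooth_on U f -> (forall x, U x -> f x != 0) ->
  smooth_on U (fun y => (f y)^-1).
Proof.
move=> oU sf f0; apply/smooth_onP; elim=> [|m IH]; split => //.
- by move=> x Ux; apply: differentiableV; [exact: (smooth_diff sf)|exact: f0].
- by move=> x Ux; apply: differentiableV; [exact: (smooth_diff sf)|exact: f0].
move=> k; apply: (@eq_on_Cn _ _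
  (fun y => (- 1 * (f y)^-1) * (f y)^-1 * pd k f y)) => //.
  by move=> y Uy; rewrite pdV ?mulN1r //; [exact: (smooth_diff sf)|exact: f0].
have /smooth_onP sfk := smooth_pd k sf.
by do !apply: CnM => //; exact: Cn_cst.
Qed.

Lemma smooth_expR {U f} : open U -> smooth_on U f -> smooth_on U (fun y => expR (f y)).
Proof.
have dexp (t : R) : differentiable expR t by apply/derivable1_diffP/derivable_expR.
move=> oU sf; apply/smooth_onP; elim=> [|m IH]; split => //.
- by move=> x Ux; apply: differentiable_comp => //; exact: (smooth_diff sf).
- by move=> x Ux; apply: differentiable_comp => //; exact: (smooth_diff sf).
move=> k; apply: (@eq_on_Cn _ _ (fun y => expR (f y) * pd k f y)) => //.
  by move=> y Uy; rewrite (pd_comp1 _ _ _ _ _ _ (is_derive_expR _))//; exact: (smooth_diff sf).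
have /smooth_onP sfk := smooth_pd k sf.
by apply: CnM.
Qed.

End PartialDerivatives.

(** * Mean value theorem on segments and symmetry of second partial derivatives *)

Section Schwarz.
Context {R : realType} {n : nat}.
Local Notation E := 'rV[R]_n.
Implicit Types (f g : E -> R) (x : E) (U : set E).

Lemma is_derive_line {f p v} (s : R) : differentiable f (s *: v + p) ->
  is_derive s 1 (fun t : R => f (t *: v + p)) ('D_v f (s *: v + p)).
Proof.
move=> df; pose l (t : R) : E := t *: v + p.
have dl : is_diff s l ( *:%R^~ v).
  have -> : *:%R^~ v = (fun t : R => t *: v) + (0 : R -> E) by rewrite addr0.
  exact: is_diffD.
have [ddl dlE] := dl.
have dfl : differentiable (f \o l) s by exact: differentiable_comp.
apply: DeriveDef; first exact: diff_derivable.
rewrite deriveE // (diff_comp ddl) //= dlE scale1r.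
by rewrite deriveE.
Qed.

Lemma line_MVT {f p v} {t : R} : 0 < t ->
  (forall s, 0 <= s <= t -> differentiable f (s *: v + p)) ->
  exists2 s, 0 <= s <= t & f (t *: v + p) - f p = 'D_v f (s *: v + p) * t.
Proof.
move=> t0 df.
have [||c c0t] := @MVT R (fun s => f (s *: v + p)) (fun s => 'D_v f (s *: v + p)) 0 t t0.
- by move=> s; rewrite in_itv/= => /andP[s0 st]; apply/is_derive_line/df; rewrite !ltW.
- apply: derivable_within_continuous => s; rewrite in_itv/= => st.
  exact: (@ex_derive _ _ _ _ _ _ _ (is_derive_line s (df s st))).
rewrite scale0r add0r subr0 => ->; exists c => //.
by move: c0t; rewrite in_itv/= => /andP[c0 ct]; rewrite !ltW.
Qed.

(** Two applications of the mean value theorem: in direction i to the increment [phi] of f along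
    direction j, then in direction j to [pd i f]. *)
Lemma second_difference {U f x i j} {t : R} : smooth_on U f -> 0 < t ->
  (forall (s s' : R), 0 <= s <= t -> 0 <= s' <= t ->
     U (s *: delta_mx 0 i + (s' *: delta_mx 0 j + x))) ->
  exists s s' : R, [/\ 0 <= s <= t, 0 <= s' <= t &
    f (t *: delta_mx 0 i + (t *: delta_mx 0 j + x)) - f (t *: delta_mx 0 i + x)
    - f (t *: delta_mx 0 j + x) + f x =
    pd j (pd i f) (s *: delta_mx 0 i + (s' *: delta_mx 0 j + x)) * t ^+ 2].
Proof.
move=> sf t0 HU; set ei := delta_mx 0 i; set ej := delta_mx 0 j.
have t0t : 0 <= t <= t by rewrite lexx ltW.
have z0t : (0 : R) <= 0 <= t by rewrite lexx ltW.
pose phi y := f (y + t *: ej) - f y.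
have Ui s : 0 <= s <= t -> U (s *: ei + x).
  by move=> st; have := HU s 0 st z0t; rewrite scale0r add0r.
have Uij s : 0 <= s <= t -> U (s *: ei + x + t *: ej).
  by move=> st; have := HU s t st t0t; rewrite addrAC addrA.
have dshift s : 0 <= s <= t -> is_diff (s *: ei + x) (fun y => f (y + t *: ej))
    ('d f (s *: ei + x + t *: ej)).
  move=> st; have df := smooth_diff sf _ (Uij s st).
  have dt : is_diff (s *: ei + x) (fun y : E => y + t *: ej) id.
    have -> : id = id + (0 : E -> E) by rewrite addr0.
    exact: is_diffD.
  exact: (@is_diff_comp _ _ _ _ _ _ _ _ _ dt (differentiableP df)).
have dphi (s : R) : 0 <= s <= t -> differentiable phi (s *: ei + x).
  move=> st; apply: differentiableB; first by have [] := dshift s st.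
  exact: (smooth_diff sf _ (Ui s st)).
have [s st] := line_MVT t0 dphi.
have -> : 'D_ei phi (s *: ei + x) =
    pd i f (t *: ej + (s *: ei + x)) - pd i f (s *: ei + x).
  have [d1 d1E] := dshift s st; have d2 := smooth_diff sf _ (Ui s st).
  rewrite /phi deriveB; [|exact: diff_derivable..].
  have -> : 'D_ei (fun y => f (y + t *: ej)) (s *: ei + x) = pd i f (s *: ei + x + t *: ej).
    by rewrite /pd (deriveE _ d1) d1E (deriveE _ (smooth_diff sf _ (Uij s st))).
  by rewrite [t *: ej + _]addrC.
have dpd (s' : R) : 0 <= s' <= t ->
    differentiable (pd i f) (s' *: ej + (s *: ei + x)).
  move=> s't; apply: (smooth_diff (smooth_pd i sf)).
  by rewrite addrCA; exact: HU.
have [s' s't ->] := line_MVT t0 dpd.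
rewrite /phi => e; exists s, s'; split => //.
rewrite expr2 mulrA [X in pd j _ X](addrCA (s *: ei)) -e.
rewrite (addrC x) -[_ + _ + t *: ej]addrA [x + t *: ej]addrC; ring.
Qed.

(** The second difference is symmetric in i and j, so in any small ball about x some value of one
    mixed derivative equals some value of the other, possibly at another point; continuity of both
    at x concludes. *)
Lemma pdC {U f x} i j : open U -> smooth_on U f -> U x ->
  pd i (pd j f) x = pd j (pd i f) x.
Proof.
move=> oU sf Ux.
(* F and G are opaque, otherwise unification would try to convert the two mixed partials. *)
have [F FE] : exists F, F = pd i (pd j f) by exists (pd i (pd j f)); exact: erefl.
have [G GE] : exists G, G = pd j (pd i f) by exists (pd j (pd i f)); exact: erefl.
have cF : {for x, continuous F}.
  rewrite FE; exact/differentiable_continuous/(smooth_diff (smooth_pd i (smooth_pd j sf))).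
have cG : {for x, continuous G}.
  rewrite GE; exact/differentiable_continuous/(smooth_diff (smooth_pd j (smooth_pd i sf))).
rewrite -FE -GE; apply/eqP; rewrite -subr_eq0 -normr_le0; apply/ler_addgt0Pl => e e0.
have e20 : 0 < e / 2 by rewrite divr_gt0.
have nF : \forall y \near x, `|F x - F y| < e / 2 by exact: (proj1 (cvgrPdist_lt _ _) cF _ e20).
have nG : \forall y \near x, `|G x - G y| < e / 2 by exact: (proj1 (cvgrPdist_lt _ _) cG _ e20).
have nU : \forall y \near x, U y by exact: open_nbhs_nbhs.
have /nbhs_ballP[r /= r0 rP] : \forall y \near x,
    [/\ `|F x - F y| < e / 2, `|G x - G y| < e / 2 & U y].
  by near=> y; split; near: y.
clear nF nG nU cF cG.
(* Displacements of at most t along each of two axes add up to a norm of at most 2r/3, hence stay in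
   the ball of radius r. *)
pose t := r / 3; have t0 : 0 < t by exact: divr_gt0.
have inb (k l : 'I_n) (s s' : R) : 0 <= s <= t -> 0 <= s' <= t ->
    ball x r (s *: delta_mx 0 k + (s' *: delta_mx 0 l + x)).
  move=> /andP[s0 st] /andP[s'0 s't].
  rewrite -ball_normE /= addrA opprD addrCA subrr addr0 normrN.
  apply: le_lt_trans (ler_normD _ _) _; rewrite !normrZ !ger0_norm//.
  have d1 m : `|delta_mx 0 m : E| <= 1.
    rewrite [leLHS]mx_normrE; apply/bigmax_leP; split => // -[a b] _ /=.
    by rewrite mxE; case: (_ && _); rewrite ?normr1 ?normr0.
  have : s * `|delta_mx 0 k : E| <= t * 1 by rewrite ler_pM.
  have : s' * `|delta_mx 0 l : E| <= t * 1 by rewrite ler_pM.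
  by rewrite /t; move: r0; lra.
have inU (k l : 'I_n) (s s' : R) : 0 <= s <= t -> 0 <= s' <= t ->
    U (s *: delta_mx 0 k + (s' *: delta_mx 0 l + x)).
  by move=> st s't; have [_ _] := rP _ (inb k l s s' st s't).
have [s [s' [st s't e1]]] := second_difference sf t0 (inU i j); rewrite -GE in e1.
have [q [q' [qt q't e2]]] := second_difference sf t0 (inU j i); rewrite -FE in e2.
have [_ Gs _] := rP _ (inb i j _ _ st s't).
have [Fq _ _] := rP _ (inb j i _ _ qt q't).
have FG : F (q *: delta_mx 0 j + (q' *: delta_mx 0 i + x)) =
          G (s *: delta_mx 0 i + (s' *: delta_mx 0 j + x)).
  have t20 : t ^+ 2 != 0 by rewrite expf_eq0 /= gt_eqF.
  apply: (mulIf t20).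
  by rewrite -e1 -e2 [t *: delta_mx 0 j + (_ + _)]addrCA; ring.
set p := q *: delta_mx 0 j + _ in Fq FG; set p' := s *: delta_mx 0 i + _ in Gs FG.
have -> : F x - G x = (F x - F p) - (G x - G p') by rewrite FG; ring.
by rewrite addr0 (le_trans (ler_normB _ _)) // [leRHS]splitr ltW // ltrD.
Unshelve. all: by end_near. Qed.

(** A ball is star-shaped about its centre: the mean value theorem on the segment from x reduces the
    claim to the differential, which vanishes on the basis vectors. *)
Lemma pd0_locally_cst {U f x} : open U -> U x ->
  (forall y, U y -> differentiable f y) ->
  (forall y k, U y -> pd k f y = 0) -> \forall y \near x, f y = f x.
Proof.
move=> oU Ux df f0.
have /nbhs_ballP[r /= r0 rP] : nbhs x U by exact: open_nbhs_nbhs.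
apply/nbhs_ballP; exists r => //= y xy.
have Us (s : R) : 0 <= s <= 1 -> U (s *: (y - x) + x).
  move=> /andP[s0 s1]; apply: rP; move: xy; rewrite -!ball_normE /=.
  rewrite opprD addrCA subrr addr0 normrN normrZ distrC ger0_norm// => xy.
  by apply: le_lt_trans xy; rewrite ler_piMl.
have [s st] := line_MVT ltr01 (fun s st => df _ (Us s st)).
have dfs := df _ (Us s st).
have e0 k : 'd f (s *: (y - x) + x) (delta_mx 0 k) = 0.
  by rewrite -(deriveE _ dfs); exact: (f0 _ k (Us s st)).
rewrite scale1r subrK mulr1 (deriveE _ dfs) => e; apply/eqP; rewrite -subr_eq0 e.
move: (s *: (y - x) + x) e0 => p e0.
rewrite [y - x]row_sum_delta linear_sum /= big1 // => k _.
by rewrite linearZ /= e0 scaler0.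
Qed.

End Schwarz.

(** * Riemannian geometry over a differential ring *)

Section DifferentialRing.
Context {A : comPzRingType} {n : nat} (d : 'I_n -> A -> A).
Hypothesis dD : forall k, {morph d k : a b / a + b}.
Hypothesis dM : forall k a b, d k (a * b) = d k a * b + a * d k b.
Hypothesis dC : forall i j a, d i (d j a) = d j (d i a).

Lemma der0 k : d k 0 = 0.
Proof. by apply: (addrI (d k 0)); rewrite -dD !addr0. Qed.

Lemma derN k a : d k (- a) = - d k a.
Proof. by apply/eqP; rewrite -addr_eq0 -dD addNr der0. Qed.

Lemma derB k a b : d k (a - b) = d k a - d k b.
Proof. by rewrite dD derN. Qed.

Lemma der1 k : d k 1 = 0.
Proof.
have := dM k 1 1; rewrite !mulr1 mul1r => /eqP.
by rewrite addrC -subr_eq subrr eq_sym => /eqP.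
Qed.

Lemma der_nat k (m : nat) : d k m%:R = 0.
Proof. by elim: m => [|m IH]; rewrite ?der0 // -natr1 dD IH der1 addr0. Qed.

Lemma der_sum k (I : finType) (F : I -> A) : d k (\sum_i F i) = \sum_i d k (F i).
Proof. exact: (big_morph _ (dD k) (der0 k)). Qed.

Definition dmx k {p q} (T : 'M[A]_(p, q)) : 'M[A]_(p, q) := map_mx (d k) T.

Lemma dmxE k {p q} (T : 'M[A]_(p, q)) a b : dmx k T a b = d k (T a b).
Proof. by rewrite mxE. Qed.

Lemma dmxD k {p q} (S T : 'M[A]_(p, q)) : dmx k (S + T) = dmx k S + dmx k T.
Proof. by apply/matrixP => a b; rewrite !mxE dD. Qed.

Lemma dmxN k {p q} (T : 'M[A]_(p, q)) : dmx k (- T) = - dmx k T.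
Proof. by apply/matrixP => a b; rewrite !mxE derN. Qed.

Lemma dmxM k {p q r} (S : 'M[A]_(p, q)) (T : 'M[A]_(q, r)) :
  dmx k (S *m T) = dmx k S *m T + S *m dmx k T.
Proof.
apply/matrixP => a b; rewrite !mxE der_sum -big_split; apply: eq_bigr => e _.
by rewrite dM !mxE.
Qed.

Lemma dmx_tr k {p q} (T : 'M[A]_(p, q)) : dmx k T^T = (dmx k T)^T.
Proof. by apply/matrixP => a b; rewrite !mxE. Qed.

Lemma dmxC i j {p q} (T : 'M[A]_(p, q)) : dmx i (dmx j T) = dmx j (dmx i T).
Proof. by apply/matrixP => a b; rewrite !mxE dC. Qed.

Lemma dmxZ k s {p q} (T : 'M[A]_(p, q)) : dmx k (s *: T) = d k s *: T + s *: dmx k T.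
Proof. by apply/matrixP => a b; rewrite !mxE dM. Qed.

Definition mxaddE {p q} (S T : 'M[A]_(p, q)) a b : (S + T) a b = S a b + T a b :=
  mxE _ _ _ _.
Definition mxoppE {p q} (T : 'M[A]_(p, q)) a b : (- T) a b = - T a b :=
  mxE _ _ _ _.

Lemma trmxD {p q} (S T : 'M[A]_(p, q)) : (S + T)^T = S^T + T^T.
Proof. exact: linearD. Qed.

Lemma trmxN {p q} (T : 'M[A]_(p, q)) : (- T)^T = - T^T.
Proof. exact: linearN. Qed.

(** * Covariant derivatives, curvature and the Ricci identity *)

Section Connection.
(* [Gam c a e] is Gamma^e_{ca}. *)
Variable Gam : 'I_n -> 'M[A]_n.
Hypothesis GamS : forall c a e, Gam c a e = Gam a c e.

(** With one Christoffel matrix for each c, the correction of the first index is a left product and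
    that of the second a right product by the transpose, so commutators of covariant derivatives
    become matrix algebra. *)
Definition cov c (T : 'M[A]_n) : 'M[A]_n :=
  dmx c T - Gam c *m T - T *m (Gam c)^T.
Definition covr c (v : 'rV[A]_n) : 'rV[A]_n := dmx c v - v *m (Gam c)^T.
(* [curv a b c e] is R^e_{cab}. *)
Definition curv a b : 'M[A]_n :=
  dmx a (Gam b) - dmx b (Gam a) + Gam b *m Gam a - Gam a *m Gam b.
Definition Ric a b : A := \sum_c curv c b a c.

Lemma covE c T a b : cov c T a b =
  d c (T a b) - \sum_e (Gam c a e * T e b + Gam c b e * T a e).
Proof.
rewrite /cov !mxaddE !mxoppE dmxE -addrA -opprD; congr (_ - _).
rewrite !mxE -big_split; apply: eq_bigr => e _ /=.
by rewrite mxE [Gam c b e * _]mulrC.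
Qed.

Lemma covrE c v b : covr c v 0 b = d c (v 0 b) - \sum_e Gam c b e * v 0 e.
Proof.
rewrite /covr mxaddE mxoppE dmxE; congr (_ - _); rewrite !mxE.
by apply: eq_bigr => e _; rewrite mxE mulrC.
Qed.

(** In [cov a (cov b T)] the index b is a mere label: the term Gamma^e_{ab} nabla_e T of the true
    second derivative is left out. For a torsion-free connection it is symmetric in a and b, so the
    commutator is the tensorial one. *)
Lemma ricci_identity a b T :
  cov a (cov b T) - cov b (cov a T) =
  - (curv a b *m T) - T *m (curv a b)^T.
Proof.
rewrite /cov /curv !(dmxD, dmxN, dmxM, dmx_tr) (dmxC a b).
rewrite !(mulmxDl, mulmxDr, mulmxN, mulNmx, trmxD, trmxN, trmx_mul) /=.
rewrite ?(mulmxDl, mulmxDr, mulmxN, mulNmx) !mulmxA.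
by apply/matrixP => i j; rewrite !(mxaddE, mxoppE); ring.
Qed.

Lemma ricci_identity_row a b v :
  covr a (covr b v) - covr b (covr a v) = - (v *m (curv a b)^T).
Proof.
rewrite /covr /curv !(dmxD, dmxN, dmxM, dmx_tr) (dmxC a b).
rewrite !(mulmxDl, mulmxDr, mulmxN, mulNmx, trmxD, trmxN, trmx_mul) /=.
rewrite ?(mulmxDl, mulmxDr, mulmxN, mulNmx) !mulmxA.
by apply/matrixP => i j; rewrite !(mxaddE, mxoppE); ring.
Qed.

Lemma covD c S T : cov c (S + T) = cov c S + cov c T.
Proof.
rewrite /cov dmxD mulmxDl mulmxDr.
by apply/matrixP => i j; rewrite !(mxaddE, mxoppE); ring.
Qed.

Lemma covN c T : cov c (- T) = - cov c T.
Proof.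
rewrite /cov dmxN mulNmx mulmxN.
by apply/matrixP => i j; rewrite !(mxaddE, mxoppE); ring.
Qed.

Lemma cov0 c : cov c 0 = 0.
Proof. by apply: (addrI (cov c 0)); rewrite -covD !addr0. Qed.

Lemma cov_tr_mul c v w : cov c (v^T *m w) = (covr c v)^T *m w + v^T *m covr c w.
Proof.
rewrite /cov /covr dmxM dmx_tr linearB /= trmx_mul trmxK mulmxBl mulmxBr !mulmxA.
by apply/matrixP => i j; rewrite !(mxaddE, mxoppE); ring.
Qed.

Lemma covrZ c s v : covr c (s *: v) = d c s *: v + s *: covr c v.
Proof. by rewrite /covr dmxZ scalerBr -scalemxAl addrA. Qed.

Lemma curvC a b : curv a b = - curv b a.
Proof. by rewrite /curv; apply/matrixP => i j; rewrite !(mxaddE, mxoppE); ring. Qed.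

Lemma curvE a b c e : curv a b c e = d a (Gam b c e) - d b (Gam a c e)
  + \sum_f Gam b c f * Gam a f e - \sum_f Gam a c f * Gam b f e.
Proof. by rewrite /curv !(mxaddE, mxoppE) !dmxE !mxE. Qed.

Lemma bianchi1 a b c e : curv a b c e + curv b c a e + curv c a b e = 0.
Proof.
rewrite !curvE (GamS c b e) (GamS c a e) (GamS b a e).
have sw i j k : \sum_f Gam i j f * Gam k f e = \sum_f Gam j i f * Gam k f e.
  by apply: eq_bigr => f _; rewrite GamS.
by rewrite (sw c b) (sw c a) (sw b a); ring.
Qed.

(** * Metric connections: raising indices and the symmetries of the curvature *)

Section Metric.
Variables g h : 'M[A]_n.
Hypothesis gS : g^T = g.
Hypothesis ghV : g *m h = 1%:M.
Hypothesis covg : forall c, cov c g = 0.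
Hypothesis n_ge3 : (3 <= n)%N.
(** This concerns the additive group of [A], not the connection. Positive integers can be cancelled;
    the argument k stands for the factor k + 1. *)
Hypothesis torsion_free : forall (k : nat) (x : A), x *+ k.+1 = 0 -> x = 0.

Lemma inv_metric_mul : h *m g = 1%:M.
Proof. exact: mulmx1C. Qed.

Lemma inv_metric_sym : h^T = h.
Proof.
by rewrite -[h^T]mulmx1 -ghV mulmxA -{1}gS -trmx_mul ghV trmx1 mul1mx.
Qed.

Lemma metricC a b : g a b = g b a.
Proof. by rewrite -{1}gS mxE. Qed.

Lemma inv_metricC a b : h a b = h b a.
Proof. by rewrite -{1}inv_metric_sym mxE. Qed.

Lemma inv_metric_contract a b : \sum_c h c a * g c b = (a == b)%:R.
Proof.
have /matrixP/(_ a b) := inv_metric_mul; rewrite !mxE => <-.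
by apply: eq_bigr => c _; rewrite inv_metricC.
Qed.

Lemma inv_metric_trace : \sum_a \sum_c h c a * g c a = n%:R.
Proof.
rewrite (eq_bigr (fun=> 1)) => [|a _]; last by rewrite inv_metric_contract eqxx.
by rewrite sumr_const card_ord.
Qed.

Lemma sum_sym_skew (S T : 'I_n -> 'I_n -> A) :
  (forall a b, S a b = S b a) -> (forall a b, T a b = - T b a) ->
  \sum_a \sum_b S a b * T a b = 0.
Proof.
move=> sS sT; apply: (torsion_free 1); rewrite mulr2n.
rewrite [X in X + _]exchange_big -big_split big1 //= => a _.
by rewrite -big_split big1 //= => b _; rewrite sS (sT b a); ring.
Qed.

Lemma sum_delta (b : 'I_n) (F : 'I_n -> A) : \sum_a F a * (a == b)%:R = F b.
Proof.
rewrite (bigD1 b)//= eqxx mulr1 big1 ?addr0 // => a /negPf ->.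
by rewrite mulr0.
Qed.

Lemma der_metric c a b : d c (g a b) = \sum_e (Gam c a e * g e b + Gam c b e * g a e).
Proof.
have /matrixP/(_ a b) := covg c; rewrite covE mxE => /eqP.
by rewrite subr_eq0 => /eqP.
Qed.

Lemma dmx_inv_metric c : dmx c h = - (h *m Gam c) - (Gam c)^T *m h.
Proof.
have e : dmx c g = Gam c *m g + g *m (Gam c)^T.
  by have /eqP := covg c; rewrite /cov -addrA -opprD subr_eq0 => /eqP.
have : dmx c (g *m h) = 0.
  by rewrite ghV; apply/matrixP => a b; rewrite !mxE; apply: der_nat.
rewrite dmxM e => /(congr1 (mulmx h)).
rewrite mulmx0 mulmxDr !mulmxDl !mulmxDr !mulmxA inv_metric_mul mul1mx.
rewrite -[h *m Gam c *m g *m h]mulmxA ghV mulmx1 mul1mx addrC => /eqP.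
by rewrite addr_eq0 opprD => /eqP.
Qed.

(** The Ricci identity applied to [g], all of whose covariant derivatives vanish. *)
Lemma curv_skew a b : (curv a b *m g)^T = - (curv a b *m g).
Proof.
have := ricci_identity a b g; rewrite !covg !cov0 subrr trmx_mul gS => /esym/eqP.
rewrite subr_eq0 => /eqP <-.
by [].
Qed.

(* [R4 e c a b] is the fully covariant R_{ecab}. *)
Definition R4 e c a b := (curv a b *m g) c e.

Lemma R4_skew12 e c a b : R4 e c a b = - R4 c e a b.
Proof. by rewrite /R4 -mxoppE -curv_skew [RHS]mxE. Qed.

Lemma R4_skew34 e c a b : R4 e c a b = - R4 e c b a.
Proof. by rewrite /R4 curvC mulNmx mxoppE. Qed.

Lemma R4_bianchi e c a b : R4 e c a b + R4 e a b c + R4 e b c a = 0.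
Proof.
rewrite /R4 !mxE -!big_split big1 // => f _ /=.
by rewrite -!mulrDl [curv a b c f + _]addrC addrAC addrC addrA bianchi1 mul0r.
Qed.

(** Four cyclic identities, rewritten by the two skew-symmetries and combined as B1 - B2 - B3 + B4,
    leave twice the difference of the two sides. *)
Lemma R4_pair e c a b : R4 e c a b = R4 a b e c.
Proof.
apply/eqP; rewrite -subr_eq0; apply/eqP/(torsion_free 1).
have B1 := R4_bianchi e c a b.
have B2 := R4_bianchi c e a b.
have B3 := R4_bianchi a b e c.
have B4 := R4_bianchi b a e c.
rewrite (R4_skew12 c e) (R4_skew34 c a b e) (R4_skew12 c b) in B2.
rewrite (R4_skew12 a e) (R4_skew34 e a c b) (R4_skew12 a c) (R4_skew34 c a b e) in B3.
rewrite (R4_skew12 b a) (R4_skew12 b e) (R4_skew34 b c a e) in B4.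
transitivity ((R4 e c a b + R4 e a b c + R4 e b c a)
  - (- R4 e c a b + - R4 c a e b + - R4 b c e a)
  - (R4 a b e c + - - R4 e a b c + - - R4 c a e b)
  + (- R4 a b e c + - R4 e b c a + - R4 b c e a)); first by ring.
by rewrite B1 B2 B3 B4; ring.
Qed.

Lemma h_curv a b : h *m curv a b = - ((curv a b)^T *m h).
Proof.
have := curv_skew a b; rewrite trmx_mul gS => e.
rewrite -[h *m curv a b]mulmx1 -ghV mulmxA -(mulmxA h) -[curv a b *m g]opprK -e.
by rewrite mulmxN mulNmx mulmxA inv_metric_mul mul1mx.
Qed.

Definition dot (v w : 'rV[A]_n) : A := (v *m h *m w^T) 0 0.

Lemma dotE v w : dot v w = \sum_a \sum_b h a b * v 0 a * w 0 b.
Proof.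
rewrite /dot mxE exchange_big /=; apply: eq_bigr => b _; rewrite !mxE mulr_suml.
by apply: eq_bigr => a _; ring.
Qed.

Lemma dotZr s v w : dot v (s *: w) = s * dot v w.
Proof. by rewrite /dot linearZ /= -scalemxAr mxE. Qed.

Lemma dotC v w : dot v w = dot w v.
Proof.
rewrite !dotE exchange_big; apply: eq_bigr => a _; apply: eq_bigr => b _ /=.
by rewrite inv_metricC; ring.
Qed.

Lemma dot_row v c : dot v (row c g) = v 0 c.
Proof.
have -> : v 0 c = (v *m h *m g) 0 c by rewrite -mulmxA inv_metric_mul mulmx1.
by rewrite /dot !mxE; apply: eq_bigr => a _; rewrite !mxE metricC.
Qed.

Lemma der_dot c v w : d c (dot v w) = dot (covr c v) w + dot v (covr c w).
Proof.
rewrite /dot -dmxE !dmxM dmx_tr dmx_inv_metric /covr trmxD trmxN trmx_mul trmxK.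
rewrite !(mulmxDl, mulmxDr, mulmxN, mulNmx) !mulmxA.
by rewrite !(mxaddE, mxoppE); ring.
Qed.

(** If c counted as a tensor index, the derivative would vanish. As a label of the row it leaves its
    own Christoffel term behind. *)
Lemma covr_g i c a : covr i (row c g) 0 a = \sum_e Gam i c e * g e a.
Proof.
rewrite covrE mxE der_metric big_split /=.
rewrite [X in _ - X](eq_bigr (fun e => Gam i a e * g c e)) ?addrK//.
by move=> e _; rewrite mxE.
Qed.

(** * Consequences of the Einstein equation *)

Section Einstein.
Variable Lam : A.
Hypothesis ein : forall a b, Ric a b = Lam * g a b.

(** Here [h] pairs a derivative index with the lower vector index. Skew-symmetry, in the form of
    [h_curv], carries [h] over to the upper index, and the remaining sum is [Ric]. *)
Lemma ricci_contract i e :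
  \sum_a \sum_c h c a * curv i c a e = Lam * (e == i)%:R.
Proof.
rewrite exchange_big /=.
have row_c c : \sum_a h c a * curv i c a e = \sum_f curv c i f c * h f e.
  transitivity ((h *m curv i c) c e); first by rewrite mxE.
  rewrite curvC mulmxN h_curv opprK mxE.
  by apply: eq_bigr => f _; rewrite mxE.
under eq_bigr do rewrite row_c.
rewrite exchange_big /= -inv_metric_contract mulr_sumr; apply: eq_bigr => f _.
by rewrite -mulr_suml -/(Ric f i) ein; ring.
Qed.

(** * CKY 2-forms on an Einstein background: the associated field is Killing *)

Section ConformalKillingYano.
Variables (Y : 'M[A]_n) (xi : 'rV[A]_n) (z : 'I_n -> 'I_n -> 'I_n -> A).
Hypothesis YS : Y^T = - Y.
Hypothesis z12 : forall a b c, z a b c = - z b a c.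
Hypothesis z23 : forall a b c, z a b c = - z a c b.
Hypothesis cky : forall c a b,
  cov c Y a b = g c a * xi 0 b - g c b * xi 0 a + z c a b.

(** [K] is nabla_c xi_b. [W] is nabla_i z_{cab}, with all three indices of z counted as tensor
    indices, so that it inherits the antisymmetries of z. *)
Let K c b := covr c xi 0 b.
Let W i c a b := d i (z c a b) -
  \sum_e (Gam i c e * z e a b + Gam i a e * z c e b + Gam i b e * z c a e).

Let W12 i c a b : W i c a b = - W i a c b.
Proof.
rewrite /W z12 derN opprB addrC; congr (_ + _); rewrite -sumrN.
apply: eq_bigr => e _; rewrite (z12 e a b) (z12 c e b) (z12 c a e); ring.
Qed.

Let W23 i c a b : W i c a b = - W i c b a.
Proof.
rewrite /W z23 derN opprB addrC; congr (_ + _); rewrite -sumrN.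
apply: eq_bigr => e _; rewrite (z23 e a b) (z23 c e b) (z23 c a e); ring.
Qed.

Let tr_mulE (v w : 'rV[A]_n) a b : (v^T *m w) a b = v 0 a * w 0 b.
Proof. by rewrite mxE big_ord1 mxE. Qed.

Let cky_mx c : cov c Y = (row c g)^T *m xi - xi^T *m row c g + \matrix_(a, b) z c a b.
Proof. by apply/matrixP => a b; rewrite cky !(mxaddE, mxoppE) !tr_mulE !mxE; ring. Qed.

Let cov_z i c a b : cov i (\matrix_(a, b) z c a b) a b =
  W i c a b + \sum_e Gam i c e * z e a b.
Proof.
rewrite covE mxE /W.
have -> : \sum_e (Gam i c e * z e a b + Gam i a e * z c e b + Gam i b e * z c a e)
  = \sum_e Gam i c e * z e a b + \sum_e (Gam i a e * z c e b + Gam i b e * z c a e).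
  by rewrite -big_split; apply: eq_bigr => e _ /=; ring.
rewrite opprD addrA addrAC subrK; congr (_ - _).
by apply: eq_bigr => e _; rewrite !mxE.
Qed.

Let cov_cov i c a b : cov i (cov c Y) a b =
  g c a * K i b - g c b * K i a + W i c a b + \sum_e Gam i c e * cov e Y a b.
Proof.
have -> : \sum_e Gam i c e * cov e Y a b = (\sum_e Gam i c e * g e a) * xi 0 b
    - (\sum_e Gam i c e * g e b) * xi 0 a + \sum_e Gam i c e * z e a b.
  rewrite !mulr_suml -sumrB -big_split; apply: eq_bigr => e _.
  by rewrite cky /=; ring.
rewrite cky_mx !covD covN !cov_tr_mul.
move: (cov i (\matrix_(a, b) z c a b)) (cov_z i c a b) => C Cz.
rewrite !(mxaddE, mxoppE) Cz !tr_mulE !covr_g.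
by rewrite ![row c g _ _]mxE /K; ring.
Qed.

(** The Ricci identity for Y, each second derivative being expanded by the CKY equation. The label c
    leaves a sum of Christoffel symbols times nabla_e Y, symmetric in i and c, which drops out. *)
Let cky_curv i c a b :
  g c a * K i b - g c b * K i a - g i a * K c b + g i b * K c a
  + W i c a b - W c i a b =
  - (curv i c *m Y) a b - (Y *m (curv i c)^T) a b.
Proof.
have entries (S T U V : 'M[A]_n) : S - T = - U - V -> S a b - T a b = - U a b - V a b.
  by move=> /matrixP/(_ a b); rewrite !(mxaddE, mxoppE).
rewrite -(entries _ _ _ _ (ricci_identity i c Y)) !cov_cov.
have -> : \sum_e Gam c i e * cov e Y a b = \sum_e Gam i c e * cov e Y a b.
  by apply: eq_bigr => e _; rewrite GamS.
ring.
Qed.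

(** Contraction of [cky_curv] with g^{ca}. Here [k] is the divergence of xi, [V] that of z, and [Q]
    the part of the curvature term in which no Ricci tensor appears. *)
Let contract i b (k := \sum_a \sum_c h c a * K c a)
    (V := \sum_a \sum_c h c a * W c i a b)
    (Q := \sum_a \sum_c h c a * (Y *m (curv i c)^T) a b) :
  n%:R * K i b - 2%:R * K i b + g i b * k - V = - (Lam * Y i b) - Q.
Proof.
have e1 : \sum_a \sum_c h c a * (g c a * K i b) = n%:R * K i b.
  rewrite -inv_metric_trace mulr_suml; apply: eq_bigr => a _.
  by rewrite mulr_suml; apply: eq_bigr => c _; rewrite mulrA.
have e2 : \sum_a \sum_c h c a * (g c b * K i a) = K i b.
  rewrite -[RHS]sum_delta; apply: eq_bigr => a _.
  by rewrite -inv_metric_contract mulr_sumr; apply: eq_bigr => c _; ring.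
have e3 : \sum_a \sum_c h c a * (g i a * K c b) = K i b.
  rewrite exchange_big -(sum_delta i (fun c => K c b)); apply: eq_bigr => c _ /=.
  rewrite -inv_metric_contract mulr_sumr; apply: eq_bigr => a _.
  by rewrite (inv_metricC c a) (metricC i a); ring.
have e4 : \sum_a \sum_c h c a * (g i b * K c a) = g i b * k.
  rewrite mulr_sumr; apply: eq_bigr => a _; rewrite mulr_sumr.
  by apply: eq_bigr => c _; ring.
have e5 : \sum_a \sum_c h c a * W i c a b = 0.
  apply: (sum_sym_skew (fun a c => h c a) (fun a c => W i c a b)) => a c.
    exact: inv_metricC.
  exact: W12.
have e6 : \sum_a \sum_c h c a * (curv i c *m Y) a b = Lam * Y i b.
  under eq_bigr do under eq_bigr do rewrite mxE mulr_sumr.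
  rewrite exchange_big; under eq_bigr do rewrite exchange_big.
  rewrite exchange_big /= -(sum_delta i (fun e => Lam * Y e b)).
  apply: eq_bigr => e _; rewrite -mulrA [Y e b * _]mulrC mulrA -ricci_contract.
  rewrite mulr_suml exchange_big; apply: eq_bigr => a _.
  by rewrite mulr_suml; apply: eq_bigr => c _; rewrite mulrA.
transitivity (\sum_a \sum_c h c a *
   (g c a * K i b - g c b * K i a - g i a * K c b + g i b * K c a
    + W i c a b - W c i a b)).
  rewrite -e1 -e4 /V.
  transitivity (\sum_a \sum_c h c a * (g c a * K i b)
    - \sum_a \sum_c h c a * (g c b * K i a) - \sum_a \sum_c h c a * (g i a * K c b)
    + \sum_a \sum_c h c a * (g i b * K c a) + \sum_a \sum_c h c a * W i c a b
    - \sum_a \sum_c h c a * W c i a b).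
    by rewrite e2 e3 e5; ring.
  rewrite -!(sumrB, big_split) /=; apply: eq_bigr => a _.
  by rewrite -!(sumrB, big_split) /=; apply: eq_bigr => c _; ring.
rewrite -e6 /Q -sumrN -sumrB; apply: eq_bigr => a _.
rewrite -sumrN -sumrB; apply: eq_bigr => c _; rewrite cky_curv; ring.
Qed.

(** With the indices of Y raised, the first sum is Y^{cf} R_{fbic}. Pair symmetry makes its
    symmetrization in i and b symmetric in c and f, so it vanishes against the skew [Yup]. *)
Let Q_skew i b : \sum_a \sum_c h c a * (Y *m (curv i c)^T) a b
  + \sum_a \sum_c h c a * (Y *m (curv b c)^T) a i = 0.
Proof.
pose Yup := h *m Y *m h.
have YupS c f : Yup c f = - Yup f c.
  have e : Yup^T = - Yup by rewrite /Yup !trmx_mul inv_metric_sym YS mulNmx mulmxN mulmxA.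
  by rewrite -mxoppE -e [RHS]mxE.
have QE j k : \sum_a \sum_c h c a * (Y *m (curv j c)^T) a k =
    \sum_c \sum_f Yup c f * R4 f k j c.
  rewrite exchange_big /=; apply: eq_bigr => c _.
  transitivity ((h *m Y *m (curv j c)^T) c k); first by rewrite -mulmxA mxE.
  transitivity ((Yup *m (curv j c *m g)^T) c k).
    by rewrite /Yup trmx_mul gS -[h *m Y *m h]mulmxA -!mulmxA [h *m (g *m _)]mulmxA inv_metric_mul mul1mx.
  by rewrite mxE; apply: eq_bigr => f _; congr (_ * _); rewrite mxE.
rewrite !QE -big_split /=.
under eq_bigr do rewrite -big_split /=.
rewrite exchange_big /=.
rewrite (eq_bigr (fun f => \sum_c (R4 f b i c + R4 c b i f) * Yup c f)).
  apply: (sum_sym_skew (fun f c => R4 f b i c + R4 c b i f) (fun f c => Yup c f)).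
    by move=> f c; rewrite addrC.
  by move=> f c; exact: YupS.
move=> f _; apply: eq_bigr => c _.
rewrite (R4_pair f i b c) (R4_skew12 b c) (R4_skew34 c b f i); ring.
Qed.

(** Symmetrizing [contract] removes Y, the divergence of z and [Q], and leaves (n - 2)(K_{ib} +
    K_{bi}) + 2 k g_{ib} = 0. The trace gives k = 0; then n - 2 > 0 is cancelled. *)
Lemma cky_killing i b : covr i xi 0 b = - covr b xi 0 i.
Proof.
pose k := \sum_a \sum_c h c a * K c a.
have sym j l : (n%:R - 2%:R) * (K j l + K l j) + 2%:R * (g j l * k) = 0.
  have W13 : \sum_a \sum_c h c a * W c l a j = - \sum_a \sum_c h c a * W c j a l.
    rewrite -sumrN; apply: eq_bigr => a _; rewrite -sumrN; apply: eq_bigr => c _.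
    by rewrite W12 W23 W12; ring.
  have Yjl : Y l j = - Y j l by rewrite -mxoppE -YS mxE.
  have := congr2 +%R (contract j l) (contract l j).
  rewrite -/k W13 (metricC l j) Yjl => e.
  transitivity (- (\sum_a \sum_c h c a * (Y *m (curv j c)^T) a l
     + \sum_a \sum_c h c a * (Y *m (curv l c)^T) a j)); last by rewrite Q_skew oppr0.
  transitivity (- (Lam * Y j l) - \sum_a \sum_c h c a * (Y *m (curv j c)^T) a l
    + (- (Lam * - Y j l) - \sum_a \sum_c h c a * (Y *m (curv l c)^T) a j)); last by ring.
  by rewrite -e; ring.
have n2 : n%:R - 2%:R = (n - 2)%:R :> A by rewrite natrB // ltnW.
have k0 : k = 0.
  (* The trace of [sym] is 2 (n - 2) k + 2 n k = 4 (n - 1) k. *)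
  apply: (torsion_free (4 * n - 5)).
  have -> : (4 * n - 5).+1 = (4 * (n - 1))%N by lia.
  have : \sum_a \sum_c h c a *
      ((n%:R - 2%:R) * (K c a + K a c) + 2%:R * (g c a * k)) = 0.
    by rewrite big1 // => a _; rewrite big1 // => c _; rewrite sym mulr0.
  have kT : \sum_a \sum_c h c a * K a c = k.
    by rewrite exchange_big /=; apply: eq_bigr => a _; apply: eq_bigr => c _; rewrite inv_metricC.
  move=> <-; transitivity ((n%:R - 2%:R) * (k + k) + 2%:R * (n%:R * k)).
    by rewrite -[LHS]mulr_natl natrM natrB; [ring|lia].
  rewrite -{2}kT -inv_metric_trace /k -big_split /= !mulr_suml !mulr_sumr -big_split /=.
  apply: eq_bigr => a _; rewrite -big_split /= !mulr_suml !mulr_sumr -big_split /=.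
  by apply: eq_bigr => c _; ring.
have := sym i b; rewrite k0 !mulr0 addr0 n2 mulr_natl => e.
apply/eqP; rewrite -addr_eq0; apply/eqP/(torsion_free (n - 3)).
by have -> : (n - 3).+1 = (n - 2)%N by lia.
Qed.

End ConformalKillingYano.

(** * Functions whose Hessian is a multiple of the metric *)

Section Potential.
Variables phi s : A.
Hypothesis dLam : forall k, d k Lam = 0.
Let v := \row_b d b phi.
Hypothesis hess : forall c, covr c v = s *: row c g.

Let m : A := n%:R - 1.

(** In the Ricci identity for d phi, [eq_curv], contraction over a and b turns the left side into n
    d_i s - d_i s and the right side into a Ricci term. *)
Lemma der_hess i : m * d i s = - Lam * d i phi.
Proof.
have eq_curv c a b : d c s * g a b - d a s * g c b
    = - \sum_f v 0 f * curv c a b f.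
  have entries (S T U : 'rV[A]_n) : S - T = - U -> S 0 b - T 0 b = - U 0 b.
    by move=> /matrixP/(_ 0 b); rewrite !(mxaddE, mxoppE).
  transitivity (covr c (covr a v) 0 b - covr a (covr c v) 0 b).
    have cz j l : covr j (covr l v) 0 b =
        d j s * g l b + s * \sum_e Gam j l e * g e b.
      rewrite hess covrZ mxaddE; congr (_ + _); first by rewrite !mxE.
      by rewrite mxE covr_g.
    rewrite !cz [in X in _ - (_ + _ * X)](eq_bigr (fun e => Gam c a e * g e b)).
      by ring.
    by move=> e _; rewrite GamS.
  rewrite (entries _ _ _ (ricci_identity_row c a v)) mxE.
  by congr (- _); apply: eq_bigr => f _; congr (_ * _); rewrite mxE.
transitivity (\sum_a \sum_b h b a * (d i s * g b a - d b s * g i a)).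
  have -> : \sum_a \sum_b h b a * (d i s * g b a - d b s * g i a) =
     (\sum_a \sum_b h b a * g b a) * d i s
     - \sum_b d b s * \sum_a h a b * g a i.
    rewrite mulr_suml [X in _ = _ - X](eq_bigr _ (fun b _ => mulr_sumr _ _ _ _)).
    rewrite [X in _ = _ - X]exchange_big /= -sumrB; apply: eq_bigr => a _.
    rewrite mulr_suml -sumrB; apply: eq_bigr => b _.
    by rewrite (inv_metricC a b) (metricC a i); ring.
  rewrite inv_metric_trace (eq_bigr _ (fun b _ => congr1 _ (inv_metric_contract _ _))) sum_delta /m; ring.
transitivity (- \sum_f v 0 f * \sum_a \sum_b h b a * curv i b a f).
  rewrite -sumrN; under [RHS]eq_bigr do rewrite mulr_sumr -sumrN.
  rewrite [RHS]exchange_big /=; apply: eq_bigr => a _.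
  under [RHS]eq_bigr do rewrite mulr_sumr -sumrN.
  rewrite [RHS]exchange_big /=; apply: eq_bigr => b _.
  rewrite eq_curv mulrN mulr_sumr -sumrN; apply: eq_bigr => f _; ring.
under eq_bigr do rewrite ricci_contract mulrA.
by rewrite sum_delta mxE; ring.
Qed.

Lemma der_normsq c : d c (dot v v) = 2%:R * s * d c phi.
Proof. by rewrite der_dot hess dotC dotZr dot_row mxE; ring. Qed.

Lemma der_hess_const c : d c (Lam * phi + m * s) = 0.
Proof. by rewrite dD !dM dLam /m derB der_nat der1 -/m der_hess; ring. Qed.

(** The terms 2 m s d_c phi cancel, and what remains is 2 phi times the identity [der_hess]. *)
Lemma der_einstein_const c :
  d c (Lam * phi * phi + 2%:R * m * phi * s - m * dot v v) = 0.
Proof.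
have dm : d c m = 0 by rewrite /m derB der_nat der1 subr0.
rewrite derB dD !dM dLam dm der_nat der_normsq.
transitivity (2%:R * phi * (m * d c s - - Lam * d c phi)); first by ring.
by rewrite der_hess subrr mulr0.
Qed.

Section KillingField.
Variables (xi : 'rV[A]_n) (al : A).
Hypothesis killing : forall c b, covr c xi 0 b = - covr b xi 0 c.
Hypothesis dal : forall c, d c al = 0.
Hypothesis xi_phi : dot xi v = al * phi.

(** Differentiate xi(phi) = al phi and contract with the gradient of phi. The Killing equation makes
    nabla xi skew, so its contraction with two copies of the gradient vanishes ([kz]). *)
Lemma scaling_normsq : s * (al * phi) = al * dot v v.
Proof.
have e b : dot (covr b xi) v + s * xi 0 b = al * v 0 b.
  have := congr1 (d b) xi_phi; rewrite der_dot hess dotZr dot_row => ->.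
  by rewrite dM dal mxE mul0r add0r.
pose vup a := \sum_b h a b * v 0 b.
have dotv w : dot w v = \sum_a w 0 a * vup a.
  rewrite dotE; apply: eq_bigr => a _; rewrite mulr_sumr.
  by apply: eq_bigr => b _; ring.
have kz : \sum_b dot (covr b xi) v * vup b = 0.
  under eq_bigr do rewrite dotv mulr_suml.
  rewrite -[RHS](sum_sym_skew (fun a b => vup a * vup b) (fun a b => covr a xi 0 b)) //.
    by apply: eq_bigr => a _; apply: eq_bigr => b _; ring.
  by move=> a b; rewrite mulrC.
rewrite -xi_phi [dot v v]dotv [dot xi v]dotv !mulr_sumr.
rewrite -[LHS]add0r -[X in X + _]kz -big_split; apply: eq_bigr => b _ /=.
by rewrite [RHS]mulrA -e; ring.
Qed.

End KillingField.
End Potential.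

End Einstein.

(** Lowering an index commutes with covariant differentiation because the metric is parallel. *)
Lemma cov_lower (X : 'I_n -> A) a b :
  d a (\sum_e g b e * X e) - \sum_e Gam a b e * (\sum_f g e f * X f) =
  \sum_e g b e * (d a (X e) + \sum_f Gam a f e * X f).
Proof.
have -> : d a (\sum_e g b e * X e) = \sum_e g b e * d a (X e)
    + \sum_e \sum_f (Gam a b f * g f e) * X e
    + \sum_e \sum_f (Gam a e f * g b f) * X e.
  rewrite der_sum -!big_split; apply: eq_bigr => e _ /=.
  by rewrite dM der_metric -!mulr_suml big_split /=; ring.
have -> : \sum_e \sum_f Gam a b f * g f e * X e =
    \sum_e Gam a b e * \sum_f g e f * X f.
  rewrite exchange_big; apply: eq_bigr => e _; rewrite mulr_sumr.
  by apply: eq_bigr => f _; ring.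
rewrite addrAC addrK exchange_big -big_split; apply: eq_bigr => e _ /=.
by rewrite mulrDr; congr (_ + _); rewrite mulr_sumr; apply: eq_bigr => f _; ring.
Qed.

Lemma lie_metric (X : 'I_n -> A) a b (xi := \row_b \sum_e g b e * X e) :
  \sum_c (X c * d c (g a b) + g c b * d a (X c) + g a c * d b (X c)) =
  covr a xi 0 b + covr b xi 0 a.
Proof.
have e i j : covr i xi 0 j = \sum_e g j e * (d i (X e) + \sum_f Gam i f e * X f).
  rewrite -cov_lower covrE mxE; congr (_ - _).
  by apply: eq_bigr => e _; rewrite mxE.
rewrite !e -big_split /=.
have s j i : \sum_e g i e * (\sum_f Gam j f e * X f) =
    \sum_c X c * \sum_e Gam c j e * g i e.
  under eq_bigr do rewrite mulr_sumr.
  rewrite exchange_big; apply: eq_bigr => c _; rewrite mulr_sumr.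
  by apply: eq_bigr => k _; rewrite GamS /=; ring.
transitivity (\sum_e g b e * d a (X e) + \sum_e g b e * (\sum_f Gam a f e * X f)
  + (\sum_e g a e * d b (X e) + \sum_e g a e * (\sum_f Gam b f e * X f))).
  rewrite !s -!big_split; apply: eq_bigr => c _ /=.
  rewrite der_metric big_split /= (metricC c b).
  by rewrite (eq_bigr (fun e => Gam c a e * g b e)); [ring|move=> k _; rewrite (metricC k)].
by rewrite -!big_split; apply: eq_bigr => c _ /=; ring.
Qed.

(** * The Ricci tensor under a conformal change of metric *)

Section ConformalChange.
Variable u : 'I_n -> A.
Hypothesis du : forall a b, d a (u b) = d b (u a).

Definition uup e := \sum_l h e l * u l.

(* The difference between the Christoffel symbols of e^{2f} g and of g, where [u] is df. *)
Definition chr_shift c : 'M[A]_n :=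
  \matrix_(a, e) ((e == c)%:R * u a + (e == a)%:R * u c - g c a * uup e).

Let uu := \sum_e u e * uup e.
Let div := \sum_c d c (uup c) + \sum_c \sum_e Gam c e c * uup e.

Lemma lower_uup a : \sum_e g a e * uup e = u a.
Proof.
rewrite /uup; under eq_bigr do rewrite mulr_sumr.
rewrite exchange_big /= -(sum_delta a u); apply: eq_bigr => l _.
by rewrite -inv_metric_contract mulr_sumr; apply: eq_bigr => e _; rewrite (metricC a); ring.
Qed.

Let ScS c a e : chr_shift c a e = chr_shift a c e.
Proof. by rewrite !mxE (metricC a c); ring. Qed.

(** Together with [Sc_mid] and [Sc_trace], this evaluates every sum in which the shift is
    contracted, so its definition need not be expanded in the products of Christoffel symbols
    below. *)
Let Sc_up b a (F : 'I_n -> A) :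
  \sum_f chr_shift b a f * F f = F b * u a + F a * u b - g b a * \sum_f uup f * F f.
Proof.
rewrite -(sum_delta b (fun f => F f * u a)) -(sum_delta a (fun f => F f * u b)).
rewrite mulr_sumr -big_split -sumrB; apply: eq_bigr => f _.
by rewrite mxE /=; ring.
Qed.

Let Sc_mid b (F : 'I_n -> 'I_n -> A) :
  \sum_c \sum_f chr_shift b f c * F c f =
  \sum_f u f * F b f + u b * \sum_c F c c - \sum_c \sum_f g b f * uup c * F c f.
Proof.
rewrite -(sum_delta b (fun c => \sum_f u f * F c f)) mulr_sumr -big_split -sumrB.
apply: eq_bigr => c _.
rewrite -(sum_delta c (fun f => u b * F c f)) mulr_suml -big_split -sumrB.
by apply: eq_bigr => f _; rewrite mxE /= (eq_sym c f); ring.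
Qed.

Let Sc_trace f : \sum_c chr_shift c f c = n%:R * u f.
Proof.
transitivity (\sum_(c < n) (1 * u f) + \sum_c u c * (c == f)%:R - \sum_c g f c * uup c).
  rewrite -big_split -sumrB; apply: eq_bigr => c _.
  by rewrite mxE eqxx (metricC f c) /=; ring.
by rewrite sum_delta lower_uup addrK -mulr_suml sumr_const card_ord.
Qed.

Let Sc_quadratic a b :
  \sum_c \sum_f chr_shift c a f * chr_shift b f c = (n%:R + 2%:R) * u a * u b - 2%:R * g a b * uu.
Proof.
under eq_bigr do under eq_bigr do rewrite mulrC.
rewrite Sc_mid Sc_trace; under eq_bigr do rewrite mulrC.
rewrite Sc_up.
have -> : \sum_c \sum_f g b f * uup c * chr_shift c a f = g a b * uu.
  have e f : \sum_c uup c * chr_shift c a f = (f == a)%:R * uu.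
    under eq_bigr do rewrite ScS mxE.
    transitivity (\sum_c uup c * (c == f)%:R * u a
      + \sum_c (f == a)%:R * (u c * uup c) - uup f * \sum_c g a c * uup c).
      rewrite mulr_sumr -big_split -sumrB; apply: eq_bigr => c _.
      by rewrite (eq_sym f c) /=; ring.
    by rewrite -mulr_suml sum_delta lower_uup -mulr_sumr -/uu; ring.
  rewrite exchange_big (metricC a b) -(sum_delta a (fun f => g b f * uu)).
  apply: eq_bigr => f _ /=; transitivity (g b f * ((f == a)%:R * uu)); last by ring.
  rewrite -e mulr_sumr.
  by apply: eq_bigr => c _; ring.
have -> : \sum_f uup f * u f = uu by apply: eq_bigr => f _; rewrite mulrC.
by rewrite (metricC b a); ring.
Qed.

(** Substituting Gam + shift gives eight sums involving the shift: [s1] to [s7] and [Sc_quadratic].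
    The derivatives of [g] left in [s1] cancel, by [s8], the non-tensorial remainders of [s6] and
    [s7]; the traces [X] in [s4] cancel those in [s6] and [s7]. *)
Lemma Ric_conformal (Gam' : 'I_n -> 'M[A]_n) a b :
  (forall c a e, Gam' c a e = Gam c a e + chr_shift c a e) ->
  \sum_c (d c (Gam' b a c) - d b (Gam' c a c)
     + \sum_f Gam' b a f * Gam' c f c - \sum_f Gam' c a f * Gam' b f c)
  = Ric a b - (n%:R - 2%:R) * (d a (u b) - \sum_e Gam a b e * u e - u a * u b)
    - (div + (n%:R - 2%:R) * uu) * g a b.
Proof.
move=> Gam'E; pose X f := \sum_c Gam c f c.
have s1 : \sum_c d c (chr_shift b a c) =
    2%:R * d a (u b) - \sum_c d c (g b a) * uup c - g b a * \sum_c d c (uup c).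
  transitivity (\sum_c d c (u a) * (c == b)%:R + \sum_c d c (u b) * (c == a)%:R
    - \sum_c d c (g b a) * uup c - g b a * \sum_c d c (uup c)).
    rewrite mulr_sumr -big_split -!sumrB; apply: eq_bigr => c _.
    by rewrite mxE /= derB dD !dM !der_nat; ring.
  by rewrite !sum_delta (du b a); ring.
have s2 : \sum_c d b (chr_shift c a c) = n%:R * d a (u b).
  by rewrite -der_sum Sc_trace dM der_nat (du b a); ring.
have s3 : \sum_c \sum_f Gam b a f * chr_shift c f c = n%:R * \sum_f Gam a b f * u f.
  rewrite exchange_big mulr_sumr; apply: eq_bigr => f _.
  by rewrite -mulr_sumr Sc_trace GamS; ring.
have s4 : \sum_c \sum_f chr_shift b a f * Gam c f c =
    X b * u a + X a * u b - g b a * \sum_f uup f * X f.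
  rewrite exchange_big /= -Sc_up; apply: eq_bigr => f _.
  by rewrite -mulr_sumr.
have s5 : \sum_c \sum_f chr_shift b a f * chr_shift c f c =
    n%:R * (2%:R * u a * u b - g b a * uu).
  transitivity (\sum_f chr_shift b a f * (n%:R * u f)).
    by rewrite exchange_big; apply: eq_bigr => f _; rewrite -mulr_sumr Sc_trace.
  rewrite Sc_up /uu; have -> : \sum_f uup f * (n%:R * u f) = n%:R * \sum_e u e * uup e.
    by rewrite mulr_sumr; apply: eq_bigr => f _; ring.
  by ring.
have s6 : \sum_c \sum_f Gam c a f * chr_shift b f c =
    \sum_f Gam a b f * u f + u b * X a
    - \sum_c (\sum_f Gam c a f * g b f) * uup c.
  under eq_bigr do under eq_bigr do rewrite mulrC.
  rewrite Sc_mid; congr (_ + _ - _).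
    by apply: eq_bigr => f _; rewrite GamS mulrC.
  by apply: eq_bigr => c _; rewrite mulr_suml; apply: eq_bigr => f _; ring.
have s7 : \sum_c \sum_f chr_shift c a f * Gam b f c =
    \sum_f Gam a b f * u f + u a * X b
    - \sum_c (\sum_f Gam c b f * g f a) * uup c.
  rewrite exchange_big; under eq_bigr do under eq_bigr do rewrite ScS.
  rewrite Sc_mid; congr (_ + _ - _).
  - by apply: eq_bigr => f _; rewrite GamS mulrC.
  - by congr (_ * _); apply: eq_bigr => f _; rewrite GamS.
  apply: eq_bigr => c _; rewrite mulr_suml; apply: eq_bigr => f _.
  by rewrite (GamS c b) (metricC a f); ring.
have s8 : \sum_c d c (g b a) * uup c =
    \sum_c (\sum_f Gam c a f * g b f) * uup c + \sum_c (\sum_f Gam c b f * g f a) * uup c.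
  rewrite -big_split; apply: eq_bigr => c _ /=.
  by rewrite der_metric big_split /=; ring.
transitivity (Ric a b + \sum_c d c (chr_shift b a c) - \sum_c d b (chr_shift c a c)
  + \sum_c \sum_f Gam b a f * chr_shift c f c + \sum_c \sum_f chr_shift b a f * Gam c f c
  + \sum_c \sum_f chr_shift b a f * chr_shift c f c - \sum_c \sum_f Gam c a f * chr_shift b f c
  - \sum_c \sum_f chr_shift c a f * Gam b f c - \sum_c \sum_f chr_shift c a f * chr_shift b f c).
  rewrite /Ric -!(sumrB, big_split) /=; apply: eq_bigr => c _.
  rewrite curvE !Gam'E !dD.
  have -> : \sum_f Gam' b a f * Gam' c f c = \sum_f Gam b a f * Gam c f c
     + \sum_f Gam b a f * chr_shift c f c + \sum_f chr_shift b a f * Gam c f c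
     + \sum_f chr_shift b a f * chr_shift c f c.
    by rewrite -!big_split; apply: eq_bigr => f _ /=; rewrite !Gam'E; ring.
  have -> : \sum_f Gam' c a f * Gam' b f c = \sum_f Gam c a f * Gam b f c
     + \sum_f Gam c a f * chr_shift b f c + \sum_f chr_shift c a f * Gam b f c
     + \sum_f chr_shift c a f * chr_shift b f c.
    by rewrite -!big_split; apply: eq_bigr => f _ /=; rewrite !Gam'E; ring.
  by ring.
have -> : div = \sum_c d c (uup c) + \sum_f uup f * X f.
  congr (_ + _); rewrite exchange_big; apply: eq_bigr => f _ /=.
  by rewrite mulr_sumr; apply: eq_bigr => c _; rewrite mulrC.
rewrite s1 s2 s3 s4 s5 s6 s7 s8 Sc_quadratic (metricC b a); ring.
Qed.

(* [div] is the Laplacian of f, hence the trace of its Hessian. *)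
Lemma hess_trace :
  \sum_a \sum_b h b a * (d a (u b) - \sum_e Gam a b e * u e) = div.
Proof.
have e a b : d a (u b) - \sum_e Gam a b e * u e =
    \sum_e g b e * (d a (uup e) + \sum_f Gam a f e * uup f).
  rewrite -cov_lower lower_uup; congr (_ - _).
  by apply: eq_bigr => e _; rewrite lower_uup.
under eq_bigr do under eq_bigr do rewrite e mulr_sumr.
rewrite /div -big_split; apply: eq_bigr => a _ /=.
rewrite exchange_big -(sum_delta a (fun e => d a (uup e) + \sum_f Gam a f e * uup f)).
apply: eq_bigr => j _ /=; rewrite (eq_sym j a) -inv_metric_contract mulr_sumr.
by apply: eq_bigr => b _; ring.
Qed.

End ConformalChange.

End Metric.
End Connection.

(** * The Levi-Civita connection and its conformal change *)

Section LeviCivita.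
Variables (half : A) (g h : 'M[A]_n).
Hypothesis halfE : half + half = 1.
Hypothesis gS : g^T = g.
Hypothesis ghV : g *m h = 1%:M.

Definition chr (g h : 'M[A]_n) c : 'M[A]_n := \matrix_(a, e)
  (half * \sum_l h e l * (d c (g l a) + d a (g l c) - d l (g c a))).

Lemma chrS c a e : chr g h c a e = chr g h a c e.
Proof.
rewrite !mxE; congr (_ * _); apply: eq_bigr => l _.
by rewrite (metricC _ gS a c); ring.
Qed.

Lemma chr_lower c a b : \sum_e chr g h c a e * g e b =
  half * (d c (g b a) + d a (g b c) - d b (g c a)).
Proof.
pose F l := d c (g l a) + d a (g l c) - d l (g c a).
rewrite -/(F b) -(sum_delta b F) mulr_sumr.
transitivity (\sum_e \sum_l half * (h e l * F l * g e b)).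
  by apply: eq_bigr => e _; rewrite mxE mulr_sumr mulr_suml; apply: eq_bigr => l _; rewrite /F; ring.
rewrite exchange_big; apply: eq_bigr => l _ /=.
rewrite -(inv_metric_contract _ _ gS ghV) mulr_sumr mulr_sumr.
by apply: eq_bigr => e _; ring.
Qed.

Lemma cov_chr c : cov (chr g h) c g = 0.
Proof.
apply/matrixP => a b; rewrite covE mxE big_split /= chr_lower.
rewrite (eq_bigr (fun e => chr g h c b e * g e a)); last first.
  by move=> e _; rewrite (metricC _ gS a).
rewrite chr_lower (metricC _ gS c b) (metricC _ gS c a) (metricC _ gS b a).
transitivity ((1 - (half + half)) * d c (g a b)); first by ring.
by rewrite halfE subrr mul0r.
Qed.

(** [E] stands for e^{2f} with [u] = df, and [E'] for its inverse; only the logarithmic derivative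
    of [E] enters. *)
Lemma chr_conformal (E E' : A) (u : 'I_n -> A) c a e : E * E' = 1 ->
  (forall k, d k E = 2%:R * u k * E) ->
  chr (E *: g) (E' *: h) c a e = chr g h c a e + chr_shift g h u c a e.
Proof.
move=> EV dE; rewrite !mxE.
transitivity (half * \sum_l h e l * (d c (g l a) + d a (g l c) - d l (g c a))
  + (half + half) * (\sum_l h e l * (g l a * u c) + \sum_l h e l * (g l c * u a)
   - g c a * uup h u e)).
  rewrite /uup [g c a * _]mulr_sumr -big_split -sumrB !mulr_sumr -big_split.
  apply: eq_bigr => l _ /=; rewrite !mxE !dM !dE.
  transitivity (half * ((E * E') * (h e l * (d c (g l a) + d a (g l c) - d l (g c a)))
    + (E * E') * (h e l * (2%:R * u c * g l a + 2%:R * u a * g l c - 2%:R * u l * g c a)))).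
    by ring.
  by rewrite EV; ring.
rewrite halfE mul1r; congr (_ + (_ - _)); rewrite [RHS]addrC.
have hd j v : \sum_l h e l * (g l j * v) = (e == j)%:R * v.
  rewrite -(inv_metric_contract _ _ gS ghV) mulr_suml; apply: eq_bigr => l _.
  by rewrite (inv_metricC _ _ gS ghV e l); ring.
by rewrite !hd.
Qed.

End LeviCivita.

(** * Einstein CKY--RS structures over a differential ring *)

Section EinsteinConformalKillingYano.
(** [U], [E] and [phi] stand for u, e^{2u} and e^{-u}, related only by product and derivative rules;
    [q] is the inverse of n - 2. *)
Variables (half q lam Lam phi E U : A) (g h Y : 'M[A]_n) (xi : 'rV[A]_n).
Variable z : 'I_n -> 'I_n -> 'I_n -> A.
Hypothesis halfE : half + half = 1.
Hypothesis qE : q * (n%:R - 2%:R) = 1.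
Hypothesis n_ge3 : (3 <= n)%N.
Hypothesis torsion_free : forall (k : nat) (x : A), x *+ k.+1 = 0 -> x = 0.
Hypothesis dlam : forall k, d k lam = 0.
Hypothesis dLam : forall k, d k Lam = 0.
Hypothesis gS : g^T = g.
Hypothesis ghV : g *m h = 1%:M.
Hypothesis phiE : E * (phi * phi) = 1.
Hypothesis dE : forall k, d k E = 2%:R * d k U * E.
Hypothesis dphi : forall k, d k phi = - d k U * phi.
Hypothesis YS : Y^T = - Y.
Hypothesis z12 : forall a b c, z a b c = - z b a c.
Hypothesis z23 : forall a b c, z a b c = - z a c b.

Let Gam := chr half g h.
Hypothesis ein : forall a b, Ric Gam a b = Lam * g a b.
Hypothesis cky : forall c a b,
  cov Gam c Y a b = g c a * xi 0 b - g c b * xi 0 a + z c a b.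

Let X a := \sum_b h a b * xi 0 b.
Let xiU := \sum_a X a * d a U.
Let T := E *: g.
Let RicT a b := Ric (chr half T ((phi * phi) *: h)) a b.
Hypothesis soliton : forall a b, RicT a b + half *
  \sum_c (X c * d c (T a b) + T c b * d a (X c) + T a c * d b (X c)) = lam * T a b.

Let c := lam - xiU.
Let v := \row_b d b phi.
Let m : A := n%:R - 1.

Let GamS := chrS half _ h gS : forall c a e, Gam c a e = Gam a c e.
Let covg := cov_chr _ _ _ halfE gS ghV.

Let cky_field_killing i b : covr Gam i xi 0 b = - covr Gam b xi 0 i.
Proof. exact: (cky_killing _ GamS _ _ gS ghV covg n_ge3 torsion_free _ ein _ _ _ YS z12 z23 cky). Qed.

Let xiE : xi = \row_b \sum_e g b e * X e.
Proof.
have -> : xi = \row_b (xi *m h *m g) 0 b by apply/rowP => b; rewrite -mulmxA inv_metric_mul // mulmx1 mxE.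
apply/rowP => b; rewrite !mxE; apply: eq_bigr => e _; rewrite mxE mulr_suml mulr_sumr.
apply: eq_bigr => l _; rewrite (metricC _ gS e b) (inv_metricC _ _ gS ghV e l); ring.
Qed.

(** Since xi is Killing for [g], the Lie derivative of E g is xi(E) g = 2 xi(U) E g. *)
Let ricci_conformal_einstein a b : RicT a b = c * (E * g a b).
Proof.
have TE : T a b = E * g a b by rewrite mxE.
have lieE : \sum_c (X c * d c (T a b) + T c b * d a (X c) + T a c * d b (X c)) =
    2%:R * xiU * (E * g a b).
  transitivity (E * \sum_c (X c * d c (g a b) + g c b * d a (X c) + g a c * d b (X c))
     + 2%:R * E * g a b * xiU).
    rewrite !mulr_sumr -big_split; apply: eq_bigr => k _ /=.
    by rewrite !mxE dM dE; ring.
  by rewrite (lie_metric _ GamS _ gS covg) -xiE cky_field_killing; ring.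
transitivity (lam * T a b - (half + half) * xiU * (E * g a b)).
  by rewrite -soliton lieE; ring.
by rewrite TE halfE /c; ring.
Qed.

Let u b := d b U.
Let uu := \sum_e u e * uup h u e.
Let div := \sum_c d c (uup h u c) + \sum_c \sum_e Gam c e c * uup h u e.
(** For two conformal Einstein metrics, [Ric_conformal] says that (n - 2)(Hess U - dU dU) is a
    multiple of [g]; solving for the factor gives [t]. *)
Let t := q * (Lam - c * E - div - (n%:R - 2%:R) * uu).

Let du i j : d i (u j) = d j (u i).
Proof. by rewrite /u dC. Qed.

Let hess_U a b : d a (u b) - \sum_e Gam a b e * u e - u a * u b = t * g a b.
Proof.
have := Ric_conformal _ GamS _ _ gS ghV covg u du (chr half T ((phi * phi) *: h)) a b
  (fun i j k => chr_conformal half g h halfE gS ghV E (phi * phi) u i j k phiE dE).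
under eq_bigr do rewrite -curvE.
rewrite -/(Ric _ a b) -/(RicT a b) ricci_conformal_einstein ein -/uu -/div => e.
set H := d a (u b) - _ - _ in e *.
transitivity (q * ((n%:R - 2%:R) * H)); first by rewrite mulrA qE mul1r.
rewrite /t -[RHS]mulrA; congr (q * _).
transitivity (Lam * g a b - (div + (n%:R - 2%:R) * uu) * g a b - c * (E * g a b)).
  by rewrite e; ring.
ring.
Qed.

Let div_t : div = uu + n%:R * t.
Proof.
rewrite -[LHS](hess_trace Gam _ _ gS ghV covg u).
transitivity (\sum_a \sum_b (h b a * (t * g b a) + h b a * (u a * u b))).
  apply: eq_bigr => a _; apply: eq_bigr => b _.
  by rewrite (metricC _ gS b a) -hess_U; ring.
under eq_bigr do rewrite big_split.
rewrite big_split [RHS]addrC; congr (_ + _); last first.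
  apply: eq_bigr => a _; rewrite /uup mulr_sumr; apply: eq_bigr => b _.
  by rewrite (inv_metricC _ _ gS ghV b a); ring.
rewrite -(inv_metric_trace _ _ gS ghV) mulr_suml; apply: eq_bigr => a _.
by rewrite mulr_suml; apply: eq_bigr => b _; ring.
Qed.

(** As phi = e^{-U}, Hess phi = - phi (Hess U - dU dU). *)
Let s := - (t * phi).

Let hess_phi i : covr Gam i v = s *: row i g.
Proof.
apply/rowP => b; rewrite covrE !mxE dphi dM derN dphi.
transitivity (- (t * g i b) * phi); last by rewrite /s; ring.
rewrite -hess_U /u.
have -> : \sum_e Gam i b e * v 0 e = - (\sum_e Gam i b e * d e U) * phi.
  rewrite -sumrN mulr_suml; apply: eq_bigr => e _; rewrite [v _ _]mxE dphi; ring.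
ring.
Qed.

Let normsq_phi : dot h v v = phi * phi * uu.
Proof.
rewrite dotE /uu mulr_sumr; apply: eq_bigr => a _; rewrite /uup !mulr_sumr.
by apply: eq_bigr => b _; rewrite !mxE !dphi /u; ring.
Qed.

(** Eliminating the Laplacian of U between [t] and its trace identity [div_t] gives c E = Lam - 2 (n
    - 1) t - (n - 1) |dU|^2; multiplication by phi^2 = 1/E yields the formula. *)
Let einstein_constantE :
  c = Lam * phi * phi + 2%:R * m * phi * s - m * dot h v v.
Proof.
have nt : (n%:R - 2%:R) * t = Lam - c * E - div - (n%:R - 2%:R) * uu.
  by rewrite /t mulrA [_ * q]mulrC qE mul1r.
rewrite normsq_phi /s /m.
transitivity (c * (E * (phi * phi))); first by rewrite phiE mulr1.
transitivity ((Lam - ((n%:R - 2%:R) * t + div + (n%:R - 2%:R) * uu)) * (phi * phi)).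
  by rewrite nt; ring.
by rewrite div_t; ring.
Qed.

Let d_einstein_constant k : d k c = 0.
Proof.
rewrite einstein_constantE.
exact: (der_einstein_const _ GamS _ _ gS ghV covg _ ein _ _ dLam hess_phi).
Qed.

Let xi_phi : dot h xi v = (c - lam) * phi.
Proof.
transitivity (- xiU * phi); last by rewrite /c; ring.
rewrite (dotC _ _ gS ghV) dotE /xiU mulNr mulr_suml -sumrN.
apply: eq_bigr => a _; rewrite /X !mulr_suml -sumrN; apply: eq_bigr => b _.
by rewrite mxE dphi; ring.
Qed.

Let einstein_constant_scaling : s * ((c - lam) * phi) = (c - lam) * dot h v v.
Proof.
apply: (scaling_normsq _ _ _ gS ghV covg torsion_free _ _ hess_phi _ _ cky_field_killing) => // k.
by rewrite derB d_einstein_constant dlam subrr.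
Qed.

Let d_hess_constant k : d k (Lam * phi + m * s) = 0.
Proof. exact: (der_hess_const _ GamS _ _ gS ghV covg _ ein _ _ dLam hess_phi). Qed.

Lemma einstein_cky_structure :
  [/\ forall a b, RicT a b = c * (E * g a b), forall k, d k c = 0,
    dot h xi v = (c - lam) * phi &
    exists s, [/\ forall i, covr Gam i v = s *: row i g,
      forall k, d k (Lam * phi + m * s) = 0,
      c = Lam * phi * phi + 2%:R * m * phi * s - m * dot h v v &
      s * ((c - lam) * phi) = (c - lam) * dot h v v]].
Proof.
split; [exact: ricci_conformal_einstein|exact: d_einstein_constant|exact: xi_phi|].
exists s; split; [exact: hess_phi|exact: d_hess_constant|exact: einstein_constantE|].
exact: einstein_constant_scaling.
Qed.

End EinsteinConformalKillingYano.
End DifferentialRing.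

(** * The differential ring of smooth functions on an open set *)

Section SmoothFunctions.
Context {R : realType} {n : nat}.
Local Notation E := 'rV[R]_n.

(* Smooth functions on the open set [U], normalized to vanish off [U] so that
   they are determined by their values on [U]. *)
Record smooth_fun {U : set E} (oU : open U) := SmoothFun {
  sfun :> E -> R;
  _ : `[< smooth_on U sfun /\ forall x, ~ U x -> sfun x = 0 >] }.

Context {U : set E} (oU : open U).
Local Notation A := (smooth_fun oU).

HB.instance Definition _ := [isSub for @sfun U oU].
HB.instance Definition _ := [Choice of A by <:].

Lemma sfun_smooth (f : A) : smooth_on U f.
Proof. by case: f => f /= /asboolP[]. Qed.

Lemma sfun_out (f : A) x : ~ U x -> f x = 0.
Proof. by case: f => f /= /asboolP[_ f0] nUx; exact: f0. Qed.

Lemma sfunP (f g : A) : (forall x, U x -> f x = g x) -> f = g.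
Proof.
move=> fg; apply/val_inj/funext => x /=.
by have [Ux|nUx] := pselect (U x); [exact: fg|rewrite !sfun_out].
Qed.

Fact restrict_subproof (f : E -> R) : smooth_on U f ->
  `[< smooth_on U (f \_ U) /\ forall x, ~ U x -> (f \_ U) x = 0 >].
Proof.
move=> sf; apply/asboolP; split; last by move=> x nUx; rewrite patchE memNset.
by apply: (smooth_ext (f := f)) => // y Uy; rewrite patchE mem_set.
Qed.

Definition sfun_of {f : E -> R} (sf : smooth_on U f) : A :=
  @SmoothFun U oU _ (restrict_subproof f sf).

Lemma sfun_ofE {f : E -> R} (sf : smooth_on U f) x : U x -> sfun_of sf x = f x.
Proof. by move=> Ux; rewrite /= patchE mem_set. Qed.

Definition sfun_cst (c : R) : A := sfun_of (smooth_cst c oU).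
Definition sfun_add (f g : A) : A :=
  sfun_of (smoothD oU (sfun_smooth f) (sfun_smooth g)).
Definition sfun_mul (f g : A) : A :=
  sfun_of (smoothM oU (sfun_smooth f) (sfun_smooth g)).
Definition sfun_opp (f : A) : A := sfun_mul (sfun_cst (- 1)) f.

Let opp_val f x : U x -> sfun_opp f x = - f x.
Proof. by move=> Ux; rewrite !sfun_ofE // mulN1r. Qed.

Fact sfun_addA : associative sfun_add.
Proof. by move=> f g h; apply: sfunP => x Ux; rewrite !sfun_ofE // addrA. Qed.
Fact sfun_addC : commutative sfun_add.
Proof. by move=> f g; apply: sfunP => x Ux; rewrite !sfun_ofE // addrC. Qed.
Fact sfun_add0 : left_id (sfun_cst 0) sfun_add.
Proof. by move=> f; apply: sfunP => x Ux; rewrite !sfun_ofE // add0r. Qed.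
Fact sfun_addN : left_inverse (sfun_cst 0) sfun_opp sfun_add.
Proof.
by move=> f; apply: sfunP => x Ux; rewrite !sfun_ofE // mulN1r addNr.
Qed.
HB.instance Definition _ :=
  GRing.isZmodule.Build A sfun_addA sfun_addC sfun_add0 sfun_addN.

Fact sfun_mulA : associative sfun_mul.
Proof. by move=> f g h; apply: sfunP => x Ux; rewrite !sfun_ofE // mulrA. Qed.
Fact sfun_mulC : commutative sfun_mul.
Proof. by move=> f g; apply: sfunP => x Ux; rewrite !sfun_ofE // mulrC. Qed.
Fact sfun_mul1 : left_id (sfun_cst 1) sfun_mul.
Proof. by move=> f; apply: sfunP => x Ux; rewrite !sfun_ofE // mul1r. Qed.
Fact sfun_mulDl : left_distributive sfun_mul sfun_add.
Proof.
by move=> f g h; apply: sfunP => x Ux; rewrite !sfun_ofE // mulrDl.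
Qed.
HB.instance Definition _ :=
  GRing.Zmodule_isComPzRing.Build A sfun_mulA sfun_mulC sfun_mul1 sfun_mulDl.

Section Evaluation.
Variables (x : E) (Ux : U x).

Lemma sfunD (f g : A) : (f + g) x = f x + g x.
Proof. exact: sfun_ofE. Qed.

Lemma sfunM (f g : A) : (f * g) x = f x * g x.
Proof. exact: sfun_ofE. Qed.

Lemma sfunN (f : A) : (- f) x = - f x.
Proof. exact: opp_val. Qed.

Lemma sfun_cstE c : sfun_cst c x = c.
Proof. exact: sfun_ofE. Qed.

Lemma sfun1 : (1 : A) x = 1.
Proof. exact: sfun_cstE. Qed.

Lemma sfun0 : (0 : A) x = 0.
Proof. exact: sfun_cstE. Qed.

Lemma sfun_sum (I : finType) (F : I -> A) : (\sum_i F i) x = \sum_i F i x.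
Proof. exact: (big_morph (fun f : A => f x) sfunD sfun0). Qed.

Lemma sfun_prod (I : finType) (F : I -> A) : (\prod_i F i) x = \prod_i F i x.
Proof. exact: (big_morph (fun f : A => f x) sfunM sfun1). Qed.

Lemma sfunMn (f : A) m : (f *+ m) x = f x *+ m.
Proof. by elim: m => [|m IH]; rewrite ?sfun0 // !mulrS sfunD IH. Qed.

Lemma sfunX (f : A) m : (f ^+ m) x = f x ^+ m.
Proof. by elim: m => [|m IH]; rewrite ?sfun1 // !exprS sfunM IH. Qed.

Definition evmx {p q} (S : 'M[A]_(p, q)) : 'M[R]_(p, q) := map_mx (fun f : A => f x) S.

Lemma evmxM {p q r} (S : 'M[A]_(p, q)) (T : 'M[A]_(q, r)) :
  evmx (S *m T) = evmx S *m evmx T.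
Proof.
apply/matrixP => a b; rewrite !mxE sfun_sum; apply: eq_bigr => e _.
by rewrite sfunM !mxE.
Qed.

Lemma evmx1 p : evmx (1%:M : 'M[A]_p) = 1%:M.
Proof. by apply/matrixP => a b; rewrite !mxE sfunMn sfun1. Qed.

Lemma sfun_det p (S : 'M[A]_p) : (\det S) x = \det (evmx S).
Proof.
rewrite /determinant sfun_sum; apply: eq_bigr => s _.
rewrite sfunM sfunX sfunN sfun1 sfun_prod; congr (_ * _).
by apply: eq_bigr => i _; rewrite mxE.
Qed.

End Evaluation.

Definition sfun_der (k : 'I_n) (f : A) : A := sfun_of (smooth_pd k (sfun_smooth f)).

Lemma sfun_derE k (f : A) (F : E -> R) x : U x -> (forall y, U y -> f y = F y) ->
  sfun_der k f x = pd k F x.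
Proof. by move=> Ux fF; rewrite sfun_ofE //; exact: (eq_on_pd k oU Ux fF). Qed.

Let sdiff (f : A) x : U x -> differentiable f x.
Proof. exact: (smooth_diff (sfun_smooth f)). Qed.

Lemma sfun_der_add k : {morph sfun_der k : f g / f + g}.
Proof.
move=> f g; apply: sfunP => x Ux; rewrite sfunD // !sfun_ofE // -pdD; [|exact: sdiff..].
by apply: (eq_on_pd k oU Ux) => y Uy; rewrite sfunD.
Qed.

Lemma sfun_der_mul k (f g : A) : sfun_der k (f * g) = sfun_der k f * g + f * sfun_der k g.
Proof.
apply: sfunP => x Ux; rewrite sfunD // !sfunM // !sfun_ofE // -pdM; [|exact: sdiff..].
by apply: (eq_on_pd k oU Ux) => y Uy; rewrite sfunM.
Qed.

Lemma sfun_der_comm i j (f : A) : sfun_der i (sfun_der j f) = sfun_der j (sfun_der i f).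
Proof.
apply: sfunP => x Ux.
have e k l : sfun_der k (sfun_der l f) x = pd k (pd l f) x.
  by apply: sfun_derE => // y Uy; exact: sfun_ofE.
by rewrite !e; exact: (pdC i j oU (sfun_smooth f) Ux).
Qed.

Lemma sfun_torsion_free (k : nat) (f : A) : f *+ k.+1 = 0 -> f = 0.
Proof.
move=> fk; apply: sfunP => x Ux; rewrite sfun0 //; apply/eqP.
have := congr1 (fun f : A => f x) fk; rewrite sfunMn // sfun0 // => /eqP.
by rewrite mulrn_eq0.
Qed.

End SmoothFunctions.

(** * Tensors over the ring of smooth functions compared with the coordinate formulas *)

Section Bridge.
Context {R : realType} {n : nat} {U : set 'rV[R]_n} (oU : open U).
Local Notation E := 'rV[R]_n.
Local Notation A := (smooth_fun oU).
Local Notation D := (sfun_der oU).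
Local Notation half := (sfun_cst oU 2^-1).

Lemma sfun_half : half + half = 1.
Proof.
apply: sfunP => x Ux; rewrite sfunD // sfun_cstE // sfun1 //.
by lra.
Qed.

Lemma sfun_der_cst k c : D k (sfun_cst oU c) = 0.
Proof.
apply: sfunP => x Ux; rewrite (sfun_derE _ _ _ (fun=> c)) ?sfun0 ?pd_cst //.
by move=> y Uy; exact: sfun_cstE.
Qed.

Section Metric.
Variables (g : E -> 'M[R]_n) (G H : 'M[A]_n).
Hypothesis GE : forall x a b, U x -> G a b x = g x a b.
Hypothesis HE : forall x a b, U x -> H a b x = invmx (g x) a b.

Lemma chrE x c a e : U x -> chr D half G H c a e x = christoffel g e c a x.
Proof.
move=> Ux; rewrite mxE sfunM // sfun_cstE // sfun_sum //; congr (_ * _).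
apply: eq_bigr => l _; rewrite sfunM // HE //; congr (_ * _).
rewrite !(sfunD, sfunN) //.
by congr (_ + _ - _); apply: sfun_derE => // y Uy; exact: GE.
Qed.

Lemma RicE x a b : U x -> Ric D (chr D half G H) a b x = ricci g x a b.
Proof.
move=> Ux; rewrite mxE /Ric sfun_sum //; apply: eq_bigr => c _.
rewrite curvE !(sfunD, sfunN) // !sfun_sum // -addrA; congr (_ - _ + _).
- by apply: sfun_derE => // y Uy; rewrite chrE.
- by apply: sfun_derE => // y Uy; rewrite chrE.
rewrite -sumrB; apply: eq_bigr => e _.
by rewrite !sfunM // !chrE // [X in X - _]mulrC [X in _ - X]mulrC.
Qed.

Lemma nabla2E (y : E -> 'M[R]_n) (Y : 'M[A]_n) x c a b : U x ->
  (forall x a b, U x -> Y a b x = y x a b) ->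
  cov D (chr D half G H) c Y a b x = nabla2 g y c a b x.
Proof.
move=> Ux YE; rewrite covE sfunD // sfunN // sfun_sum //; congr (_ - _).
  by apply: sfun_derE => // z Uz; rewrite YE.
by apply: eq_bigr => e _; rewrite sfunD // !sfunM // !chrE // !YE.
Qed.

End Metric.

(* By Cramer's rule. *)
Lemma smooth_inverse (g : E -> 'M[R]_n) (G : 'M[A]_n) :
  (forall x a b, U x -> G a b x = g x a b) -> (forall x, U x -> g x \in unitmx) ->
  exists2 H : 'M[A]_n, G *m H = 1%:M &
    forall x a b, U x -> H a b x = invmx (g x) a b.
Proof.
move=> GE gU.
have evG x : U x -> evmx oU x G = g x.
  by move=> Ux; apply/matrixP => a b; rewrite mxE GE.
have detE x : U x -> (\det G) x = \det (g x) by move=> Ux; rewrite sfun_det // evG.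
have sdet : smooth_on U (fun x => ((\det G) x)^-1).
  apply: smoothV => //; first exact: sfun_smooth.
  by move=> x Ux; rewrite detE // -unitfE -unitmxE gU.
have GH : G *m (sfun_of oU sdet *: \adj G) = 1%:M.
  rewrite -scalemxAr mul_mx_adj scale_scalar_mx; congr (_%:M).
  apply: sfunP => x Ux; rewrite sfunM // sfun_ofE // sfun1 // mulVf //.
  by rewrite detE // -unitfE -unitmxE gU.
exists (sfun_of oU sdet *: \adj G) => // x a b Ux.
have := congr1 (evmx oU x) GH; rewrite evmxM // evmx1 // evG // => e.
have -> : invmx (g x) = evmx oU x (sfun_of oU sdet *: \adj G).
  by rewrite -[RHS](mulKmx (gU x Ux)) e mulmx1.
by rewrite [RHS]mxE.
Qed.

End Bridge.

(** * The local theorem in a single chart *)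

Section LocalTheorem.
Context {R : realType} {n : nat} {U : set 'rV[R]_n}.
Local Notation E := 'rV[R]_n.
Variables (g Y : E -> 'M[R]_n) (u : E -> R) (lambda Lambda : R).
Hypothesis n_ge3 : (3 <= n)%N.
Hypothesis oU : open U.
Hypothesis sg : forall a b, smooth_on U (fun x => g x a b).
Hypothesis sY : forall a b, smooth_on U (fun x => Y x a b).
Hypothesis su : smooth_on U u.
Hypothesis gS : forall x, U x -> (g x)^T = g x.
Hypothesis gU : forall x, U x -> g x \in unitmx.
Hypothesis YS : forall x, U x -> (Y x)^T = - Y x.
Hypothesis cky : forall x, U x -> cky_eq g Y x.

Let gt (x : E) : 'M[R]_n := expR (2 * u x) *: g x.
Hypothesis ein : forall x, U x -> ricci g x = Lambda *: g x.
Hypothesis soliton : forall x, U x ->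
  ricci gt x + 2^-1 *: lie2 (cky_vec g Y) gt x = lambda *: gt x.

Let phi (x : E) : R := expR (- u x).
Let c (x : E) : R := lambda - lie0 (cky_vec g Y) u x.
Let N (x : E) : R := covec_normsq (g x) (grad phi x).

(** The identities of [einstein_cky_structure], proved in the ring of smooth functions on [U], are
    evaluated at the points of [U]. *)
Lemma local_structure :
  [/\ forall x, U x -> ricci gt x = c x *: gt x,
    smooth_on U c, forall x k, U x -> pd k c x = 0,
    forall x, U x -> lie0 (cky_vec g Y) phi x = (c x - lambda) * phi x &
    exists s : E -> R, [/\ smooth_on U s,
      forall x a b, U x -> pd a (pd b phi) x
        - \sum_e christoffel g e a b x * pd e phi x = s x * g x a b,
      forall x k, U x -> pd k (fun y => Lambda * phi y + (n%:R - 1) * s y) x = 0 &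
      forall x, U x -> c x = Lambda * phi x * phi x
          + 2 * (n%:R - 1) * phi x * s x - (n%:R - 1) * N x /\
        s x * ((c x - lambda) * phi x) = (c x - lambda) * N x]].
Proof.
pose A := smooth_fun oU; pose D := sfun_der oU; pose half := sfun_cst oU 2^-1.
pose G : 'M[A]_n := \matrix_(a, b) sfun_of oU (sg a b).
have GE x a b : U x -> G a b x = g x a b by move=> Ux; rewrite mxE sfun_ofE.
have [H GH HE] := smooth_inverse oU g G GE gU.
pose YA : 'M[A]_n := \matrix_(a, b) sfun_of oU (sY a b).
have YE x a b : U x -> YA a b x = Y x a b by move=> Ux; rewrite mxE sfun_ofE.
pose Gam := chr D half G H.
pose xi : 'rV[A]_n := \row_a (sfun_cst oU (n%:R - 1)^-1 *
  \sum_b \sum_c H b c * cov D Gam c YA b a).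
have xiE x a : U x -> xi 0 a x = cky_covec g Y x 0 a.
  move=> Ux; rewrite mxE [RHS]mxE sfunM // sfun_cstE // sfun_sum //.
  congr (_ * _); apply: eq_bigr => b _; rewrite sfun_sum //; apply: eq_bigr => e _.
  by rewrite sfunM // HE // (nabla2E oU g G H GE HE Y YA).
pose X a := \sum_b H a b * xi 0 b.
have XE x a : U x -> X a x = cky_vec g Y x 0 a.
  move=> Ux; rewrite /X mxE sfun_sum //; apply: eq_bigr => b _.
  by rewrite sfunM // HE // xiE.
(* [cky_eq] supplies z point by point, with no smoothness in x. Taken as the remainder of the CKY
   equation, z is an element of the ring. *)
pose z a b e := cov D Gam a YA b e - (G a b * xi 0 e - G a e * xi 0 b).
have zE x : U x -> exists2 z' : 'I_n -> 'I_n -> 'I_n -> R,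
    totally_antisym z' & forall a b e, z a b e x = z' a b e.
  move=> Ux; have [z' z'S e'] := cky x Ux.
  (* The differentiated index comes last in [cky_eq] and first in [z], whence this cyclic
     relabelling. *)
  exists (fun a b e => z' b e a) => a b e.
    split; last by have [] := z'S b e a.
    by have [-> _] := z'S b e a; have [_ ->] := z'S e b a; have [-> _] := z'S e a b; rewrite opprK.
  rewrite /z !(sfunD, sfunN, sfunM) // (nabla2E oU g G H GE HE Y YA) // e'.
  rewrite !GE // !xiE //; ring.
have z12 a b e : z a b e = - z b a e.
  apply: sfunP => x Ux; rewrite sfunN //; have [z' z'S zz] := zE x Ux.
  by rewrite !zz; have [] := z'S a b e.
have z23 a b e : z a b e = - z a e b.
  apply: sfunP => x Ux; rewrite sfunN //; have [z' z'S zz] := zE x Ux.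
  by rewrite !zz; have [] := z'S a b e.
have sphi : smooth_on U phi.
  apply: smooth_expR => //.
  apply: (smooth_ext (f := fun y => - 1 * u y)) => //; first by move=> y _; rewrite mulN1r.
  by apply: smoothM => //; exact: smooth_cst.
have sE : smooth_on U (fun y => expR (2 * u y)).
  by apply: smooth_expR => //; apply: smoothM => //; exact: smooth_cst.
pose phiA := sfun_of oU sphi; pose EA := sfun_of oU sE; pose UA := sfun_of oU su.
have du x : U x -> differentiable u x by exact: (smooth_diff su).
have EphiE : EA * (phiA * phiA) = 1.
  apply: sfunP => x Ux; rewrite !sfunM // sfun1 // !sfun_ofE // /phi.
  by rewrite -!expRD -[RHS]expR0; congr expR; ring.
have dEA k : D k EA = 2 * D k UA * EA.
  apply: sfunP => x Ux; rewrite !sfunM // sfunMn // sfun1 //.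
  rewrite (sfun_derE oU k _ (fun y => expR (2 * u y))) //; last by move=> y Uy; exact: sfun_ofE.
  rewrite (sfun_derE oU k _ u) //; last by move=> y Uy; exact: sfun_ofE.
  rewrite (pd_comp1 _ _ _ _ _ _ (is_derive_expR _)); last first.
    by apply: differentiableM => //; exact: du.
  by rewrite pdM //; [rewrite pd_cst sfun_ofE //; ring|exact: du].
have dphiA k : D k phiA = - D k UA * phiA.
  apply: sfunP => x Ux; rewrite sfunM // sfunN //.
  rewrite (sfun_derE oU k _ phi) //; last by move=> y Uy; exact: sfun_ofE.
  rewrite (sfun_derE oU k _ u) //; last by move=> y Uy; exact: sfun_ofE.
  rewrite (pd_comp1 _ _ _ _ _ _ (is_derive_expR _)); last first.
    by apply: differentiableN; exact: du.
  by rewrite pdN; [rewrite sfun_ofE // /phi; ring|exact: du].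
have YAS : YA^T = - YA.
  apply/matrixP => a b; rewrite !mxE; apply: sfunP => x Ux.
  rewrite sfunN // !sfun_ofE //.
  by have /matrixP/(_ a b) := YS x Ux; rewrite !mxE.
have GS : G^T = G.
  apply/matrixP => a b; rewrite !mxE; apply: sfunP => x Ux; rewrite !sfun_ofE //.
  by have /matrixP/(_ a b) := gS x Ux; rewrite mxE.
have einA a b : Ric D Gam a b = sfun_cst oU Lambda * G a b.
  apply: sfunP => x Ux; rewrite (RicE oU g G H GE HE) // sfunM // sfun_cstE // GE //.
  by rewrite ein // mxE.
have ckyA a b e : cov D Gam a YA b e = G a b * xi 0 e - G a e * xi 0 b + z a b e.
  by rewrite /z; ring.
have TE x a b : U x -> (EA *: G) a b x = gt x a b.
  by move=> Ux; rewrite mxE sfunM // sfun_ofE // GE // mxE.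
have THE x a b : U x -> ((phiA * phiA) *: H) a b x = invmx (gt x) a b.
  move=> Ux; rewrite mxE !sfunM // !sfun_ofE // HE // invmxZ ?gU //.
    by rewrite mxE /phi -expRD -expRN; congr (expR _ * _); ring.
  by rewrite unitmxZ ?gU // unitfE gt_eqF ?expR_gt0.
have solA a b : Ric D (chr D half (EA *: G) ((phiA * phiA) *: H)) a b + half *
    \sum_c (X c * D c ((EA *: G) a b) + (EA *: G) c b * D a (X c)
      + (EA *: G) a c * D b (X c)) = sfun_cst oU lambda * (EA *: G) a b.
  apply: sfunP => x Ux; rewrite sfunD // (RicE oU gt _ _ TE THE) // !sfunM // !sfun_cstE //.
  rewrite TE //; transitivity ((lambda *: gt x) a b); last by rewrite [LHS]mxE.
  rewrite -(soliton x Ux) [RHS]mxE [X in _ = _ + X]mxE [lie2 _ _ _ _ _]mxE.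
  congr (_ + _ * _); rewrite sfun_sum //; apply: eq_bigr => k _.
  rewrite !(sfunD, sfunM) // !XE // !TE //.
  by congr (_ * _ + _ * _ + _ * _); apply: sfun_derE => // y Uy; rewrite ?TE ?XE.
have qE : sfun_cst oU (n%:R - 2)^-1 * (n%:R - 2) = 1.
  apply: sfunP => x Ux; rewrite sfunM // sfun_cstE // sfunD // sfunN // !sfunMn // sfun1 //.
  rewrite mulVf // subr_eq0 eqr_nat; apply/eqP => n2.
  by move: n_ge3; rewrite n2.
have [Ric_c dc xiphi [s [hess dk cE scal]]] :=
  einstein_cky_structure D (sfun_der_add oU) (sfun_der_mul oU) (sfun_der_comm oU)
    half _ (sfun_cst oU lambda) (sfun_cst oU Lambda) phiA EA UA G H YA xi z
    (sfun_half oU) qE n_ge3 (sfun_torsion_free oU) (fun k => sfun_der_cst oU k lambda)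
    (fun k => sfun_der_cst oU k Lambda) GS GH EphiE dEA dphiA YAS z12 z23 einA ckyA solA.
rewrite -/(\sum_a X a * D a UA) in Ric_c dc xiphi cE scal.
set cA := sfun_cst oU lambda - _ in Ric_c dc xiphi cE scal.
have cAE x : U x -> cA x = c x.
  move=> Ux; rewrite /cA sfunD // sfunN // sfun_cstE // sfun_sum //; congr (_ - _).
  apply: eq_bigr => a _; rewrite sfunM // -/(X a) XE //; congr (_ * _).
  by apply: sfun_derE => // y Uy; rewrite sfun_ofE.
have vE x a : U x -> (\row_b D b phiA) 0 a x = grad phi x 0 a.
  by move=> Ux; rewrite !mxE; apply: sfun_derE => // y Uy; rewrite sfun_ofE.
have NE x : U x -> dot H (\row_b D b phiA) (\row_b D b phiA) x = N x.
  move=> Ux; rewrite dotE sfun_sum //; apply: eq_bigr => a _; rewrite sfun_sum //.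
  by apply: eq_bigr => b _; rewrite !sfunM // HE // !vE.
have natE x m : U x -> (m%:R : A) x = m%:R by move=> Ux; rewrite sfunMn // sfun1.
split.
- move=> x Ux; apply/matrixP => a b; rewrite -(RicE oU gt _ _ TE THE) // Ric_c.
  by rewrite !sfunM // cAE // GE // sfun_ofE // !mxE.
- by apply: (smooth_ext _ oU cAE); exact: sfun_smooth.
- by move=> x k Ux; rewrite -(sfun_derE oU k cA c x Ux cAE) -/D dc sfun0.
- move=> x Ux; have := congr1 (fun f : A => f x) xiphi.
  rewrite sfunM // sfunD // sfunN // cAE // sfun_cstE // sfun_ofE // => <-.
  rewrite (dotC G H GS GH) dotE sfun_sum // /lie0; apply: eq_bigr => a _.
  rewrite -XE // /X !sfun_sum // mulr_suml; apply: eq_bigr => b _.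
  by rewrite !sfunM // vE // [grad phi x 0 a]mxE; ring.
exists s; split; first exact: sfun_smooth.
- move=> x a b Ux; have /rowP/(_ b) := hess a; rewrite covrE [RHS]mxE => e.
  have := congr1 (fun f : A => f x) e.
  rewrite sfunM // sfunD // sfunN // [row a G 0 b]mxE GE // => <-.
  congr (_ - _).
    by apply/esym/sfun_derE => // y Uy; rewrite vE // mxE.
  rewrite sfun_sum //; apply: eq_bigr => e' _.
  by rewrite sfunM // vE // (chrE oU g G H GE HE) // [RHS]mulrC mulrC mxE.
- move=> x k Ux; have := congr1 (fun f : A => f x) (dk k).
  rewrite sfun0 // => <-; apply/esym/sfun_derE => // y Uy.
  by rewrite sfunD // !sfunM // sfunD // sfunN // natE // sfun1 // sfun_cstE // sfun_ofE.
move=> x Ux; split.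
  rewrite -cAE // cE sfunD // sfunN // sfunD // !sfunM // NE // (natE x 2) // sfunD // sfunN //.
  by rewrite !natE // sfun1 // sfun_cstE // !sfun_ofE.
have := congr1 (fun f : A => f x) scal.
by rewrite !sfunM // NE // sfunD // sfunN // cAE // sfun_cstE // sfun_ofE.
Qed.

End LocalTheorem.

(** * Passage from charts to the manifold *)

Section ChangeOfCoordinates.
Context {R : realType} {n : nat}.
Local Notation E := 'rV[R]_n.

Lemma differentiable_rV (F : E -> E) x :
  (forall b, differentiable (fun y => F y 0 b) x) -> differentiable F x.
Proof.
move=> dF.
have -> : F = \sum_(b < n) (fun y => F y 0 b *: (delta_mx 0 b : E)).
  by apply/funext => y; rewrite fct_sumE -row_sum_delta.
by apply: differentiable_sum => b; exact: differentiableZl.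
Qed.

Lemma grad_comp (F : E -> E) (f : E -> R) x :
  (forall b, differentiable (fun y => F y 0 b) x) -> differentiable f (F x) ->
  grad (fun y => f (F y)) x = grad f (F x) *m (jac F x)^T.
Proof.
move=> dF df; have dFx := differentiable_rV F x dF.
apply/rowP => a; rewrite mxE [RHS]mxE /pd -[fun y => _]/(f \o F).
rewrite deriveE; last exact: differentiable_comp.
rewrite diff_comp //= -[X in 'd f _ X]deriveE //.
rewrite derive_mx; last exact: diff_derivable.
rewrite [X in 'd f _ X]row_sum_delta linear_sum; apply: eq_bigr => b _.
by rewrite linearZ /= -deriveE // !mxE mulrC.
Qed.

Lemma covec_normsqE (G : 'M[R]_n) w : covec_normsq G w = (w *m invmx G *m w^T) 0 0.
Proof. by rewrite -[RHS]/(dot (invmx G) w w) dotE. Qed.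

(** Invertibility of the transformed metric forces that of J, and then G^{-1} = J^T (J G J^T)^{-1}
    J. *)
Lemma covec_normsq_congruence (J G : 'M[R]_n) w :
  J *m G *m J^T \in unitmx -> G \in unitmx ->
  covec_normsq (J *m G *m J^T) (w *m J^T) = covec_normsq G w.
Proof.
move=> uK uG; have := uK; rewrite !unitmx_mul => /andP[/andP[uJ _] _].
rewrite !covec_normsqE trmx_mul trmxK.
suff -> : invmx G = J^T *m invmx (J *m G *m J^T) *m J by rewrite !mulmxA.
apply: (can_inj (mulKmx uG)); rewrite mulmxV //.
apply: (can_inj (mulKmx uJ)); rewrite !mulmxA mulmx1 mulmxV // mul1mx.
by [].
Qed.

(** The norm of [w] is the value of the quadratic form [G] on the raised vector w G^{-1}, which is
    nonzero with [w]. *)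
Lemma covec_normsq_gt0 (G : 'M[R]_n) w : G^T = G -> G \in unitmx ->
  positive_definite G -> w != 0 -> 0 < covec_normsq G w.
Proof.
move=> GS uG pG w0; rewrite covec_normsqE.
have -> : w *m invmx G *m w^T = (w *m invmx G) *m G *m (w *m invmx G)^T.
  by rewrite trmx_mul trmx_inv GS mulmxKV // mulmxA.
apply: pG; apply: contraNneq w0 => e.
by rewrite -(mulmxKV uG w) e mul0mx.
Qed.

End ChangeOfCoordinates.

(** * The Einstein constant across charts, and rigidity when alpha is nonzero *)

Section Global.
Context {R : realType} {n : nat} {M : manifold R n}.
Variables (g Y : tensor2 M) (u : M -> R) (lambda Lambda : R).
Hypothesis n_ge3 : (3 <= n)%N.
Hypothesis hS : einstein_cky_rs g u Y lambda Lambda.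
Variable phi : M -> R.
Hypothesis phiE : forall p, phi p = expR (- u p).

Let C i x := lambda - lie0 (cky_vec (g i) (Y i)) (loc u i) x.
Let N i x := covec_normsq (g i x) (grad (loc phi i) x).

Lemma phi_gt0 p : 0 < phi p.
Proof. by rewrite phiE expR_gt0. Qed.

Let gi_unit i x : cod (chrt i) x -> g i x \in unitmx.
Proof. by case: hS => -[pg _ _ _] _ /pg[]. Qed.

Let phi_smooth i : smooth_on (cod (chrt i)) (loc phi i).
Proof.
have -> : loc phi i = (fun x => expR (- loc u i x)) by apply/funext => x; exact: phiE.
case: hS => -[_ su _ _] _; apply: smooth_expR; first exact: cod_open.
apply: (smooth_ext (f := fun y => - 1 * loc u i y)); first exact: cod_open.
  by move=> y _; rewrite mulN1r.
apply: smoothM; [exact: cod_open|apply: smooth_cst; exact: cod_open|exact: su].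
Qed.

Let chart_structure i :
  [/\ forall x, cod (chrt i) x -> ricci (conformal g u i) x = C i x *: conformal g u i x,
    smooth_on (cod (chrt i)) (C i), forall x k, cod (chrt i) x -> pd k (C i) x = 0,
    forall x, cod (chrt i) x ->
      lie0 (cky_vec (g i) (Y i)) (loc phi i) x = (C i x - lambda) * loc phi i x &
    exists s : 'rV[R]_n -> R, [/\ smooth_on (cod (chrt i)) s,
      forall x a b, cod (chrt i) x -> pd a (pd b (loc phi i)) x
        - \sum_e christoffel (g i) e a b x * pd e (loc phi i) x = s x * g i x a b,
      forall x k, cod (chrt i) x ->
        pd k (fun y => Lambda * loc phi i y + (n%:R - 1) * s y) x = 0 &
      forall x, cod (chrt i) x -> C i x = Lambda * loc phi i x * loc phi i x
          + 2 * (n%:R - 1) * loc phi i x * s x - (n%:R - 1) * N i x /\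
        s x * ((C i x - lambda) * loc phi i x) = (C i x - lambda) * N i x]].
Proof.
have [[pg su [Yf cky] sol] ein] := hS.
rewrite /N; have -> : loc phi i = (fun x => expR (- loc u i x)) by apply/funext => x; exact: phiE.
have H := local_structure (g i) (Y i) (loc u i) lambda Lambda n_ge3 (@cod_open _ _ _ (chrt i))
  (@comp_smooth _ _ _ g i) (@comp_smooth _ _ _ Y i) (su i) (fun x cx => proj1 (pg i x cx))
  (fun x cx => proj2 (pg i x cx)) (Yf i) (cky i) (ein i) (sol i).
exact: H.
Qed.

Lemma normsq_chart_change i j p : dom (chrt i) p -> dom (chrt j) p ->
  N i (fwd (chrt i) p) = N j (fwd (chrt j) p).
Proof.
move=> ip jp; set x := fwd (chrt i) p.
have cx : cod (chrt i) x by exact: fwd_cod.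
have bx : bwd (chrt i) x = p by exact: fwdK.
have ox : overlap (chrt i) (chrt j) x by split => //; rewrite bx.
pose tau := transition (chrt i) (chrt j).
have tx : tau x = fwd (chrt j) p by rewrite /tau /transition bx.
have cy : cod (chrt j) (tau x) by rewrite tx; exact: fwd_cod.
have -> : fwd (chrt j) p = tau x by [].
have gE := @comp_change _ _ _ g i j x ox; rewrite -/tau /= in gE.
rewrite /N.
have -> : grad (loc phi i) x = grad (loc phi j) (tau x) *m (jac tau x)^T.
  rewrite -grad_comp.
  (* The two expressions of phi agree only where chart j is defined; this holds near x, which is
     enough for the derivatives. *)
  - apply/rowP => a; rewrite !mxE; apply: near_eq_pd.
    have : \forall q \near bwd (chrt i) x, dom (chrt j) q.
      by apply: open_nbhs_nbhs; split; [exact: dom_open|rewrite bx].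
    move=> nj; have nz : \forall z \near x, dom (chrt j) (bwd (chrt i) z).
      exact: (@bwd_cont _ _ _ (chrt i) x cx _ nj).
    by apply: filterS nz => z jz; rewrite /loc /tau /transition fwdK.
  - by move=> b; exact: (smooth_diff (@atlas_smooth _ _ M i j b) _ ox).
  - exact: (smooth_diff (phi_smooth j)).
rewrite gE covec_normsq_congruence // -?gE; exact: gi_unit.
Qed.

Let near_chart (i : idx M) (P : set 'rV[R]_n) p : dom (chrt i) p ->
  (\forall x \near fwd (chrt i) p, P x) -> \forall q \near p, P (fwd (chrt i) q).
Proof. by move=> ip; exact: (@fwd_cont _ _ _ (chrt i) p ip). Qed.

Let near_dom (i : idx M) p : dom (chrt i) p -> \forall q \near p, dom (chrt i) q.
Proof. by move=> ip; apply: open_nbhs_nbhs; split => //; exact: dom_open. Qed.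

Let near_cod (i : idx M) x : cod (chrt i) x -> \forall y \near x, cod (chrt i) y.
Proof. by move=> cx; apply: open_nbhs_nbhs; split => //; exact: cod_open. Qed.

Let near_pull (i : idx M) (P : set M) x : cod (chrt i) x ->
  (\forall q \near bwd (chrt i) x, P q) -> \forall y \near x, P (bwd (chrt i) y).
Proof. by move=> cx; exact: (@bwd_cont _ _ _ (chrt i) x cx). Qed.

Let C_locally_cst i x : cod (chrt i) x -> \forall y \near x, C i y = C i x.
Proof.
have [_ sC dC _ _] := chart_structure i => cx.
exact: (pd0_locally_cst (@cod_open _ _ _ (chrt i)) cx (smooth_diff sC) dC).
Qed.

(* The constant K is Lambda phi + (n - 1) s, where s g is the Hessian of phi. *)
Let chart_integral i : exists K : 'rV[R]_n -> R, forall x, cod (chrt i) x ->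
  [/\ \forall y \near x, K y = K x,
    C i x = - (n%:R - 1) * N i x - Lambda * loc phi i x ^+ 2 + 2 * K x * loc phi i x,
    (\forall y \near x, loc phi i y = loc phi i x) -> K x = Lambda * loc phi i x &
    C i x != lambda -> N i x * (n%:R - 1) = (K x - Lambda * loc phi i x) * loc phi i x].
Proof.
have [_ _ _ _ [s [ss hess dK cE]]] := chart_structure i.
exists (fun y => Lambda * loc phi i y + (n%:R - 1) * s y) => x cx.
have oc := @cod_open _ _ _ (chrt i).
have [c1 c2] := cE x cx; split.
- apply: (pd0_locally_cst oc cx) dK => y cy.
  apply: differentiableD; apply: differentiableM; try exact: differentiable_cst.
    exact: (smooth_diff (phi_smooth i)).
  exact: (smooth_diff ss).
- by rewrite c1; ring.
- move=> phi_cst.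
  have d0 b : \forall y \near x, pd b (loc phi i) y = 0.
    apply: filterS (nbhs_interior phi_cst) => y yA.
    by rewrite (near_eq_pd _ (fun=> loc phi i x)) ?pd_cst.
  have sg a b : s x * g i x a b = 0.
    rewrite -hess // big1 => [|e _]; last by rewrite (nbhs_singleton (d0 e)) mulr0.
    by rewrite (near_eq_pd _ (fun=> 0)) ?pd_cst ?subr0.
  suff -> : s x = 0 by rewrite mulr0 addr0.
  have n0 : (0 < n)%N by apply: leq_trans n_ge3.
  (* A diagonal entry of g g^{-1} equals 1, so s g = 0 forces s = 0. *)
  have /matrixP/(_ (Ordinal n0) (Ordinal n0)) := mulmxV (gi_unit i x cx).
  rewrite !mxE eqxx mulr1n => e; rewrite -[LHS]mulr1 -e mulr_sumr big1 // => b _.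
  by rewrite mulrA sg mul0r.
- move=> Cl; suff -> : N i x = s x * loc phi i x by ring.
  have Cl' : C i x - lambda != 0 by rewrite subr_eq0.
  by apply: (mulfI Cl'); rewrite -c2; ring.
Qed.

Let C_chart_change i j p : dom (chrt i) p -> dom (chrt j) p ->
  C i (fwd (chrt i) p) = C j (fwd (chrt j) p).
Proof.
move=> ip jp.
have [Ki HKi] := chart_integral i; have [Kj HKj] := chart_integral j.
have cod_fwd (l : idx M) (q : M) : dom (chrt l) q -> cod (chrt l) (fwd (chrt l) q) by exact: fwd_cod.
have loc_fwd l q : dom (chrt l) q -> loc phi l (fwd (chrt l) q) = phi q.
  by move=> lq; rewrite /loc fwdK.
(* [D] and [B] are the discrepancies of K and of [C] between the two charts. Both are constant near
   p, while the terms in |d phi|^2 and phi^2 cancel in the difference. *)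
pose D := Ki (fwd (chrt i) p) - Kj (fwd (chrt j) p).
pose B := C i (fwd (chrt i) p) - C j (fwd (chrt j) p).
have BD : \forall q \near p, B = 2 * D * phi q.
  have [Kic _ _ _] := HKi _ (cod_fwd i p ip); have [Kjc _ _ _] := HKj _ (cod_fwd j p jp).
  have n7 := near_chart i _ p ip Kic; have n2 := near_chart j _ p jp Kjc.
  have n3 := near_chart i _ p ip (C_locally_cst i _ (cod_fwd i p ip)).
  have n4 := near_chart j _ p jp (C_locally_cst j _ (cod_fwd j p jp)).
  have n5 := near_dom i p ip; have n6 := near_dom j p jp.
  near=> q.
  have iq : dom (chrt i) q by near: q.
  have jq : dom (chrt j) q by near: q.
  have e1 : Ki (fwd (chrt i) q) = Ki (fwd (chrt i) p) by near: q.
  have e2 : Kj (fwd (chrt j) q) = Kj (fwd (chrt j) p) by near: q.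
  have e3 : C i (fwd (chrt i) q) = C i (fwd (chrt i) p) by near: q.
  have e4 : C j (fwd (chrt j) q) = C j (fwd (chrt j) p) by near: q.
  rewrite /B /D -e1 -e2 -e3 -e4.
  have [_ -> _ _] := HKi _ (cod_fwd i q iq); have [_ -> _ _] := HKj _ (cod_fwd j q jq).
  by rewrite (normsq_chart_change i j q iq jq) !loc_fwd //; ring.
suff B0 : B = 0 by apply/eqP; rewrite -subr_eq0 -/B B0.
have [D0|D0] := eqVneq D 0; first by rewrite (nbhs_singleton BD) D0 mulr0 mul0r.
(* If D were nonzero, B = 2 D phi would make phi constant near p; K would then be Lambda phi(p) in
   both charts, that is D = 0. *)
have phi_cst : \forall q \near p, phi q = phi p.
  have D20 : 2 * D != 0 by rewrite mulf_neq0 ?pnatr_eq0.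
  apply: filterS (BD) => q e; apply: (mulfI D20).
  by rewrite -e (nbhs_singleton BD).
have KE l (lp : dom (chrt l) p) K : (forall x, cod (chrt l) x ->
  [/\ \forall y \near x, K y = K x,
    C l x = - (n%:R - 1) * N l x - Lambda * loc phi l x ^+ 2 + 2 * K x * loc phi l x,
    (\forall y \near x, loc phi l y = loc phi l x) -> K x = Lambda * loc phi l x &
    C l x != lambda -> N l x * (n%:R - 1) = (K x - Lambda * loc phi l x) * loc phi l x]) ->
    K (fwd (chrt l) p) = Lambda * phi p.
  move=> HK; have [_ _ + _] := HK _ (cod_fwd l p lp); rewrite loc_fwd //; apply.
  by apply: (near_pull l (fun q => phi q = phi p) _ (cod_fwd l p lp)); rewrite fwdK.
by move/eqP: D0; case; rewrite /D (KE i ip Ki HKi) (KE j jp Kj HKj) subrr.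
Unshelve. all: by end_near. Qed.

Lemma einstein_constant_global : connected [set: M] -> (exists (i : idx M) x, cod (chrt i) x) ->
  exists c, forall (i : idx M) x, cod (chrt i) x -> C i x = c.
Proof.
move=> cM [i0 [x0 cx0]]; exists (C i0 x0).
(* [B] refers to all charts at a point. [C_chart_change] makes it nonempty and open, and local
   constancy of [C] makes its complement open; connectedness then gives the whole of [M]. *)
pose B : set M := [set p | forall i, dom (chrt i) p -> C i (fwd (chrt i) p) = C i0 x0].
have near_cst (i : idx M) p : dom (chrt i) p ->
    \forall q \near p, dom (chrt i) q /\ C i (fwd (chrt i) q) = C i (fwd (chrt i) p).
  move=> ip; have n7 := near_dom i p ip.
  have n2 := near_chart i _ p ip (C_locally_cst i _ (fwd_cod ip)).
  by near=> q; split; near: q.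
have BT : B = setT.
  apply: cM.
  - exists (bwd (chrt i0) x0) => i ip.
    by rewrite (C_chart_change i i0) ?bwdK //; exact: bwd_dom.
  - exists B; last by rewrite setTI.
    rewrite openE => p Bp; have [i ip] := atlas_cover p.
    apply: filterS (near_cst i p ip) => q [iq e] j jq.
    by rewrite (C_chart_change j i q jq iq) e; exact: Bp.
  - exists B; last by rewrite setTI.
    rewrite -openC openE => p nBp.
    have [i /not_implyP[ip nC]] : exists i, ~ (dom (chrt i) p -> C i (fwd (chrt i) p) = C i0 x0).
      by apply/existsNP.
    apply: filterS (near_cst i p ip) => q [iq e] Bq.
    by apply: nC; rewrite -e; exact: Bq.
move=> i x cx; have : B (bwd (chrt i) x) by rewrite BT.
by move=> /(_ i (bwd_dom cx)); rewrite bwdK.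
Unshelve. all: by end_near. Qed.

Lemma homothetic_rigidity c (i : idx M) x : (forall y, cod (chrt i) y -> C i y = c) ->
  c != lambda ->
  cod (chrt i) x ->
  [/\ c = 0, (n%:R - 1) * N i x = - Lambda * loc phi i x ^+ 2 & grad (loc phi i) x != 0].
Proof.
move=> Cc cl cx; have [_ _ _ lieE _] := chart_structure i.
have p0 y : loc phi i y != 0 by rewrite gt_eqF // /loc phi_gt0.
(* Where d phi vanished, xi(phi) = (c - lambda) phi would vanish too, although both factors are
   nonzero. *)
have g0 : grad (loc phi i) x != 0.
  apply/eqP => /rowP g0; have := lieE x cx; rewrite Cc // /lie0 big1 => [/esym/eqP|a _].
    by rewrite mulf_eq0 subr_eq0 (negPf cl) (negPf (p0 x)).
  by have := g0 a; rewrite !mxE => ->; rewrite mulr0.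
have [K HK] := chart_integral i.
(* Insert (n - 1) |d phi|^2 = (K - Lambda phi) phi into the expression of c. *)
have cK y : cod (chrt i) y -> c = K y * loc phi i y.
  move=> cy; have [_ e1 _ e2] := HK y cy; rewrite -(Cc y cy) e1.
  by rewrite mulNr mulrC e2 ?Cc //; ring.
have [Kc _ _ NE] := HK x cx.
(* Otherwise phi = c / K near x, with K constant there, and d phi would vanish at x. *)
have K0 : K x = 0.
  apply/eqP; apply: contraNT g0 => K0; apply/eqP/rowP => a; rewrite !mxE.
  rewrite (near_eq_pd _ (fun=> loc phi i x)) ?pd_cst //.
  have nc := near_cod i x cx.
  near=> y; apply: (mulfI K0); rewrite -cK //.
  have cy : cod (chrt i) y by near: y.
  rewrite (cK y cy); congr (_ * _); apply/esym.
  by near: y.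
split => //; first by rewrite (cK x cx) K0 mul0r.
by rewrite mulrC NE ?Cc // K0; ring.
Unshelve. all: by end_near. Qed.

Lemma conformal_einstein c : (forall (i : idx M) x, cod (chrt i) x -> C i x = c) ->
  einstein (conformal g u) c.
Proof.
by move=> Cc i x cx; have [ric _ _ _ _] := chart_structure i; rewrite ric // Cc.
Qed.

End Global.

Theorem mainTheorem11 (R : realType) (n : nat) (hn : (3 <= n)%N)
    (M : manifold R n) (hM : connected [set: M])
    (g : tensor2 M) (u : M -> R) (Y : tensor2 M) (lambda Lambda : R)
    (hS : einstein_cky_rs g u Y lambda Lambda)
    (phi : M -> R) (hphi : forall p : M, phi p = expR (- u p))
    (hdphi : exists (i : idx M) (x : 'rV[R]_n),
        cod (chrt i) x /\ grad (loc phi i) x <> 0) :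
  exists c : R,
    [/\ in_charts (fun (i : idx M) x =>
          c = lambda - lie0 (cky_vec (g i) (Y i)) (loc u i) x),
        einstein (conformal g u) c &
        let alpha := c - lambda in
        alpha <> 0 ->
        [/\ c = 0,
            in_charts (fun (i : idx M) x =>
              (n%:R - 1) * covec_normsq (g i x) (grad (loc phi i) x)
              = - Lambda * loc phi i x ^+ 2),
            riemannian g -> Lambda < 0 &
            lorentzian g ->
            [/\ 0 < Lambda -> in_charts (fun (i : idx M) x =>
                  timelike_covec (g i x) (grad (loc phi i) x)),
                Lambda = 0 -> in_charts (fun (i : idx M) x =>
                  null_covec (g i x) (grad (loc phi i) x)) &
                Lambda < 0 -> in_charts (fun (i : idx M) x =>
                  spacelike_covec (g i x) (grad (loc phi i) x))]]].
Proof.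
(* A point of [M] at which to read off the constant c, and later to test positive definiteness. *)
have [i0 [x0 [cx0 _]]] := hdphi.
have [c Cc] := einstein_constant_global g Y u lambda Lambda hn hS phi hphi hM
  (ex_intro _ i0 (ex_intro _ x0 cx0)).
exists c; split.
- by move=> i x cx; rewrite -(Cc i x cx).
- exact: (conformal_einstein g Y u lambda Lambda hn hS phi hphi c Cc).
move=> alpha alpha0.
have cl : c != lambda by apply/eqP => e; apply: alpha0; rewrite /alpha e subrr.
have H i x : cod (chrt i) x -> _ :=
  homothetic_rigidity g Y u lambda Lambda hn hS phi hphi c i x (Cc i) cl.
have nE i x (cx : cod (chrt i) x) : (n%:R - 1) * covec_normsq (g i x) (grad (loc phi i) x)
    = - Lambda * loc phi i x ^+ 2 by have [] := H i x cx.
have g0 i x (cx : cod (chrt i) x) : grad (loc phi i) x != 0 by have [] := H i x cx.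
have p0 i x : 0 < loc phi i x ^+ 2 by rewrite exprn_gt0 // /loc hphi expR_gt0.
have n0 : 0 < n%:R - 1 :> R by rewrite subr_gt0 ltr1n; apply: leq_trans hn.
split; first by have [] := H i0 x0 cx0.
- exact: nE.
(* As n - 1 and phi^2 are positive, the sign of |d phi|^2 is that of -Lambda; for a positive
   definite metric it is positive because d phi vanishes nowhere. *)
- move=> [pg posg]; have [gS gU] := pg i0 x0 cx0.
  have := mulr_gt0 n0 (covec_normsq_gt0 _ _ gS gU (posg i0 x0 cx0) (g0 i0 x0 cx0)).
  by rewrite nE // pmulr_lgt0 // oppr_gt0.
move=> _; split.
- move=> L0 i x cx; rewrite /timelike_covec -(pmulr_rlt0 _ n0) nE //.
  by rewrite pmulr_llt0 // oppr_lt0.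
- move=> L0 i x cx; split; first exact: g0.
  by apply: (mulfI (lt0r_neq0 n0)); rewrite nE // L0 oppr0 mul0r mulr0.
move=> L0 i x cx; rewrite /spacelike_covec -(pmulr_rgt0 _ n0) nE //.
by rewrite pmulr_lgt0 // oppr_gt0.
Qed.
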